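(* Let $n$ be a positive integer and let $D$ be a convex drawing of the complete graph $K_n$. Then $D$ contains a $3$-face if and only if $n \geq 3$. Moreover, $D$ contains a $4$-face if and only if $n \geq 6$.
   Context: A rectilinear drawing $D$ of $K_n$ represents the vertices of $K_n$ by $n$ distinct points in the plane $\mathbb{R}^2$, no three of which lie on a common line, and represents each edge by the line segment connecting the points representing its end-vertices. The drawing $D$ is convex if the points representing the vertices are in convex position. Identify $D$ with the union of its points and segments. A face of $D$ is a non-empty connected component of $\mathbb{R}^2 \setminus D$. Exactly one face is unbounded, and every bounded face is (the interior of) a convex polygon; the size of a bounded face is the number of vertices (corners) of this polygon. A bounded face of size $k$ is called a $k$-face of $D$. (For $n \le 2$ a drawing is a point or a segment and has no bounded face.) *)

(* Defs.v *)
From HB Require Import structures.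
From mathcomp Require Import all_boot all_order all_algebra.
From mathcomp Require Import all_classical all_reals all_analysis.

Set Implicit Arguments.
Unset Strict Implicit.
Unset Printing Implicit Defensive.

Import Order.TTheory GRing.Theory Num.Theory.
Import numFieldNormedType.Exports.

Local Open Scope classical_set_scope.
Local Open Scope ring_scope.

Section Convexity.
Variables (R : realType) (V : lmodType R).

Definition conv_hull (A : set V) : set V := smallest (@convex_set R V) A.

Definition segment (a b : V) : set V :=
  [set (1 - t) *: a + t *: b | t in [set t : R | 0 <= t <= 1]].

(* [d] is a direction vector; this is a line only when [d != 0]. *)
Definition line (a d : V) : set V := [set a + t *: d | t in [set: R]].

Definition collinear (x y z : V) : Prop :=
  exists a d : V, [/\ d != 0, line a d x, line a d y & line a d z].

(* Strict convex position: it forces the points to be pairwise distinct. *)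
Definition convex_position (k : nat) (q : 'I_k -> V) : Prop :=
  forall i, ~ conv_hull (q @` [set j | j != i]) (q i).

(* The [q i] are exactly the corners of the polygon [P]. *)
Definition convex_polygon (k : nat) (P : set V) : Prop :=
  (3 <= k)%N /\
  exists q : 'I_k -> V, convex_position q /\ P = conv_hull (range q).

End Convexity.

Section Drawing.
Variables (R : realType) (n : nat) (p : 'I_n -> R * R).

Definition rectilinear : Prop :=
  injective p /\
  forall i j k, i != j -> j != k -> i != k -> ~ collinear (p i) (p j) (p k).

Definition convex_drawing : Prop := rectilinear /\ convex_position p.

Definition drawing : set (R * R) :=
  range p `|` [set x | exists i j, i != j /\ segment (p i) (p j) x].

Definition face (F : set (R * R)) : Prop :=
  exists2 x, (~` drawing) x & F = connected_component (~` drawing) x.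

Definition kface (k : nat) (F : set (R * R)) : Prop :=
  [/\ face F, bounded_set F &
      exists P : set (R * R), convex_polygon k P /\ F = interior P].

End Drawing.

(* Main.v *)
Require Import Defs.
From mathcomp Require Import all_boot all_order all_algebra.
From mathcomp Require Import all_classical all_reals all_analysis.
From mathcomp Require Import zify ring lra.

Set Implicit Arguments.
Unset Strict Implicit.
Unset Printing Implicit Defensive.

Import Order.TTheory GRing.Theory Num.Theory.
Import numFieldNormedType.Exports.

Local Open Scope classical_set_scope.
Local Open Scope ring_scope.

(** Let the vertices be v_0, ..., v_(n-1) in counterclockwise order; such an
    order exists because, seen from one vertex of a convex position, the other
    ones are totally ordered by angle ([convex_position_ccw]).

    The faces are cells of a line arrangement. The line through two vertices
    meets the convex polygon of the vertices exactly in their chord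
    ([polygon_chord]). Hence the sign of [orient (v i) (v j)] cannot change on
    a connected set that meets the polygon and avoids the drawing, and the face
    of a point of the polygon is given by its side of each of these lines
    ([component_sub_cell]). Consequently an open cell bounded by some of the
    lines and met by no chord is a face ([component_cell]), and no chord meets
    it as soon as each chord is separated from it by a line
    ([side_excludes_segment]). A bounded face lies in the polygon, since from
    outside one can flee to infinity along a ray.

    Existence. The region between the edge v_0v_1 and the chords v_0v_2 and
    v_1v_(n-1) is always a triangular face ([exists_triangle]). For n >= 6 let x
    be the crossing of v_0v_3 and v_1v_(n-2). If x is not strictly beyond the
    chord v_2v_(n-1), then the chords v_0v_2, v_0v_3, v_1v_(n-1), v_1v_(n-2)
    bound a face ([exists_quad_near]). If it is, then v_0v_3, and with it every
    later chord from v_0, meets v_2v_(n-1) closer to v_(n-1) than v_1v_(n-2) and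
    v_1v_(n-3) do; so these two chords, v_0v_2 and v_2v_(n-1) bound a face
    ([exists_quad_far]).

    Non-existence. For n <= 2 the drawing is convex, so no face is bounded. For
    n = 3, 4, 5 each bounded face is the cell of three lines or, at the centre
    of the pentagon, of five lines none of which can be dropped
    ([face_small_non_quad]). The number of sides of an open polygon is well
    defined: a cell with k irredundant sides is not the intersection of fewer
    than k open half-planes ([irredundant_cell_size]). So none of these faces is
    a quadrilateral. *)

(** * Affine combinations, hulls and orientation *)
Section Plane.
Variable R : realType.
Local Notation pt := (R * R)%type.
Implicit Types (a b c d x y z : pt) (s t : R) (A F : set pt).

Definition mix a b t : pt := (1 - t) *: a + t *: b.

Lemma mix1 a b t : (mix a b t).1 = (1 - t) * a.1 + t * b.1.
Proof. by []. Qed.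

Lemma mix2 a b t : (mix a b t).2 = (1 - t) * a.2 + t * b.2.
Proof. by []. Qed.

Definition mixE := (mix1, mix2).

(** The predicate [convex_set] quantifies over a bundled type of weights and
    uses boolean membership; this is the same notion with plain hypotheses
    ([convexP]). *)
Definition convex A := forall a b t, A a -> A b -> 0 <= t <= 1 -> A (mix a b t).

Lemma convexP A : @convex_set R pt A <-> convex A.
Proof.
split=> [cA a b t Aa Ab /andP[t0 t1]|cA a b l /set_mem Aa /set_mem Ab].
  have := cA b a (Itv01 t0 t1) (mem_set Ab) (mem_set Aa) => /set_mem.
  by rewrite /mix addrC.
apply/mem_set.
have := cA b a l%:num Ab Aa; rewrite /mix addrC; apply.
by rewrite ge0 le1.
Qed.

Lemma hullP A x : conv_hull A x <-> forall B, convex B -> A `<=` B -> B x.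
Proof.
split=> [hx B cB AB|hx B [cB AB]].
  by apply: (hx B); split=> //; apply/convexP.
by apply: hx => //; apply/convexP.
Qed.

Lemma convex_hull A : convex (conv_hull A).
Proof.
move=> a b t /hullP Aa /hullP Ab t01; apply/hullP => B cB AB.
by apply: (cB) => //; [exact: Aa|exact: Ab].
Qed.

Lemma sub_hull A : A `<=` conv_hull A.
Proof. by move=> x Ax; apply/hullP => B _; apply. Qed.

(** Twice the signed area of the triangle [a b c]: positive when it turns
    counterclockwise. For fixed [a] and [b] this is an affine function that
    vanishes on the line through them, so it also serves as the equation of a
    half-plane. *)
Definition orient a b c : R :=
  (b.1 - a.1) * (c.2 - a.2) - (b.2 - a.2) * (c.1 - a.1).

Lemma orient_mix a b c d t :
  orient a b (mix c d t) = (1 - t) * orient a b c + t * orient a b d.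
Proof. by rewrite /orient !mixE; ring. Qed.

Lemma orient_rot a b c : orient a b c = orient b c a.
Proof. by rewrite /orient; ring. Qed.

Lemma orient_swap a b c : orient b a c = - orient a b c.
Proof. by rewrite /orient; ring. Qed.

Lemma orient_swapr a b c : orient a c b = - orient a b c.
Proof. by rewrite /orient; ring. Qed.

Lemma orient_l a b : orient a b a = 0.
Proof. by rewrite /orient; ring. Qed.

Lemma orient_r a b : orient a b b = 0.
Proof. by rewrite /orient; ring. Qed.

Lemma orient_continuous a b : continuous (orient a b).
Proof.
move=> y; rewrite /orient; apply: cvgB; apply: cvgM; try exact: cvg_cst.
  by apply: cvgB; [exact: cvg_snd|exact: cvg_cst].
by apply: cvgB; [exact: cvg_fst|exact: cvg_cst].
Qed.

Lemma open_orient a b : open [set y | 0 < orient a b y].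
Proof.
apply: (@open_comp _ _ (orient a b) [set r | 0 < r]); last exact: open_gt.
by move=> y _; exact: orient_continuous.
Qed.

Lemma mix_continuous a b : continuous (mix a b).
Proof.
move=> t; rewrite /mix; apply: cvgD; apply: cvgZr_tmp.
  by apply: cvgB; [exact: cvg_cst|exact: cvg_id].
exact: cvg_id.
Qed.

(** Every convex set is star-shaped, hence a union of segments with a common
    end. *)
Lemma convex_connected A : convex A -> connected A.
Proof.
move=> cA; have [[x0 Ax0]|/set0P/negP/negPn/eqP ->] := pselect (A !=set0);
  last exact: connected0.
rewrite [A](_ : _ = \bigcup_(y in A) (mix x0 y @` `[0, 1])).
  apply: bigcup_connected.
    by exists x0 => y Ay; exists 0;
      rewrite /= ?in_itv/= ?lexx ?ler01// /mix subr0 scale1r scale0r addr0.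
  move=> y Ay; apply: connected_continuous_connected;
    first exact: segment_connected.
  by apply: continuous_subspaceT => t; exact: mix_continuous.
apply/seteqP; split=> [y Ay|y [z Az [t]]].
  exists y => //; exists 1; rewrite /= ?in_itv/= ?lexx ?ler01//.
  by rewrite /mix subrr scale1r scale0r add0r.
by rewrite /= in_itv/= => t01 <-; exact: cA.
Qed.

(** From an interior point one can step a little backwards, away from any [z],
    and stay in the set: an affine function that is nonnegative on the set and
    not constant is therefore positive in the interior. *)
Lemma interior_overshoot A y z : interior A y ->
  exists2 t, 0 < t & A (mix y z (- t)).
Proof.
move=> Ay.
have : \forall t \near (0:R), A (mix y z t).
  apply: (@mix_continuous y z 0).
  by rewrite /mix subr0 scale1r scale0r addr0.
move=> /nbhs_ballP[e /= e0 he].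
exists (e / 2); first by rewrite divr_gt0.
apply: he; rewrite /ball/= sub0r normrN normrN gtr0_norm; lra.
Qed.

End Plane.

(** * Open cells of half-planes and polygons *)
Section Cells.
Variable R : realType.
Local Notation pt := (R * R)%type.
Implicit Types (a b c d x y z : pt) (s t : R) (A F : set pt).
Implicit Types (L l : seq (pt * pt)) (q : seq pt).

(** Barycentric coordinates: the affine function [orient a b] at [w] from its
    values at [x], [y], [z], with denominators cleared. *)
Lemma orient_bary a b x y z w :
  orient x y z * orient a b w =
  orient y z w * orient a b x + orient z x w * orient a b y
  + orient x y w * orient a b z.
Proof. by rewrite /orient; ring. Qed.

Lemma orient_eq0 a b : (forall y, orient a b y = 0) -> a = b.
Proof.
move=> h; apply: injective_projections.
  by have := h (a.1, a.2 + 1); rewrite /orient /= => h1; lra.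
by have := h (a.1 + 1, a.2); rewrite /orient /= => h1; lra.
Qed.

Lemma convex_combination3 A a b c y (u v w : R) : 
  convex A -> A a -> A b -> A c -> 0 <= u -> 0 <= v -> 0 <= w ->
    u + v + w = 1 ->
  y.1 = u * a.1 + v * b.1 + w * c.1 -> y.2 = u * a.2 + v * b.2 + w * c.2 -> A y.
Proof.
move=> cA Aa Ab Ac u0 v0 w0 uvw y1 y2.
have [w1|w1] := eqVneq w 1.
  have ? : u = 0 by lra.
  have ? : v = 0 by lra.
  by suff -> : y = c by []; apply: injective_projections; rewrite ?y1 ?y2;
    subst; ring.
have wn : 1 - w != 0 by rewrite subr_eq0 eq_sym.
have wp : 0 < 1 - w by rewrite lt_neqAle eq_sym wn; lra.
suff -> : y = mix (mix a b (v / (1 - w))) c w.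
  apply: (cA) => //; last by apply/andP; split=> //; lra.
  apply: (cA) => //; rewrite divr_ge0 ?(ltW wp)//= ler_pdivrMr// mul1r; lra.
have ue : u = 1 - w - v by lra.
by apply: injective_projections; rewrite !mixE ?y1 ?y2 ue; field.
Qed.

(** The products keep the statement independent of the orientation of the
    triangle. *)
Lemma convex_triangle A a b c y : convex A -> A a -> A b -> A c ->
  orient a b c != 0 -> 0 <= orient a b c * orient b c y ->
  0 <= orient a b c * orient c a y -> 0 <= orient a b c * orient a b y -> A y.
Proof.
move=> cA Aa Ab Ac.
have E : orient b c y + orient c a y + orient a b y = orient a b c.
  by rewrite /orient; ring.
have E1 : orient a b c * y.1 =
    orient b c y * a.1 + orient c a y * b.1 + orient a b y * c.1.
  by rewrite /orient; ring.
have E2 : orient a b c * y.2 =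
    orient b c y * a.2 + orient c a y * b.2 + orient a b y * c.2.
  by rewrite /orient; ring.
move: (orient a b c) (orient b c y) (orient c a y) (orient a b y) E E1 E2.
move=> D u v w E E1 E2 D0 hu hv hw.
have pos r : 0 <= D * r -> 0 <= r / D.
  have -> : r / D = D * r / D ^+ 2 by field.
  by move=> h; rewrite divr_ge0// sqr_ge0.
apply: (@convex_combination3 A a b c y (u / D) (v / D) (w / D)) => //;
  try exact: pos.
- by rewrite -!mulrDl E divff.
- by apply: (mulfI D0); rewrite E1; field.
- by apply: (mulfI D0); rewrite E2; field.
Qed.

(** A pair of points stands for the open half-plane to the left of the line that
    it directs. *)
Definition cell L : set pt := [set y | all (fun e => 0 < orient e.1 e.2 y) L].

Lemma mix_gt0 (u v t : R) : 0 <= t <= 1 -> 0 < u -> 0 < v ->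
  0 < (1 - t) * u + t * v.
Proof.
move=> /andP[t0 t1] u0 v0; have [->|tn] := eqVneq t 0; first lra.
have tp : 0 < t by rewrite lt_neqAle eq_sym tn.
have h1 : 0 <= (1 - t) * u by rewrite mulr_ge0 ?subr_ge0// ltW.
by have := mulr_gt0 tp v0; lra.
Qed.

Lemma mix_ge0 (u v t : R) : 0 <= t <= 1 -> 0 <= u -> 0 <= v ->
  0 <= (1 - t) * u + t * v.
Proof. by move=> /andP[t0 t1] u0 v0; rewrite addr_ge0 ?mulr_ge0 ?subr_ge0. Qed.

Lemma convex_halfplane a b : convex [set y | 0 <= orient a b y].
Proof. by move=> y z t /= hy hz t01; rewrite orient_mix mix_ge0. Qed.

Lemma convex_cell L : convex (cell L).
Proof.
move=> y z t /allP hy /allP hz t01; apply/allP => e eL.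
by rewrite orient_mix mix_gt0// ?hy// ?hz.
Qed.

Lemma open_cell L : open (cell L).
Proof.
elim: L => [|e L IH].
  have -> : cell [::] = setT by apply/seteqP; split.
  exact: openT.
rewrite (_ : cell _ = [set y | 0 < orient e.1 e.2 y] `&` cell L).
  by apply: openI => //; exact: open_orient.
apply/seteqP; split=> [y /andP[]//|y []]; rewrite /cell /=.
by move=> -> ->.
Qed.

Definition closed_cell L : set pt :=
  [set y | all (fun e => 0 <= orient e.1 e.2 y) L].

Lemma closed_closed_cell L : closed (closed_cell L).
Proof.
elim: L => [|e L IH].
  have -> : closed_cell [::] = setT by apply/seteqP; split.
  exact: closedT.
have -> : closed_cell (e :: L) =
    [set y | 0 <= orient e.1 e.2 y] `&` closed_cell L.
  by apply/seteqP; split=> [y /andP[]//|y []]; rewrite /closed_cell /= => -> ->.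
apply: closedI => //.
apply: (@closed_comp _ _ (orient e.1 e.2) [set r | 0 <= r]);
  last exact: closed_ge.
by move=> y _; exact: orient_continuous.
Qed.

Definition side L i y : R := orient (nth (0, 0) L i).1 (nth (0, 0) L i).2 y.

Lemma side_mix L i a b t :
  side L i (mix a b t) = (1 - t) * side L i a + t * side L i b.
Proof. exact: orient_mix. Qed.

Lemma cellP L y : cell L y <-> forall i, (i < size L)%N -> 0 < side L i y.
Proof.
split=> [/(all_nthP (0, 0)) h i iL|h]; first exact: h.
by apply/(all_nthP (0, 0)) => i iL; exact: h.
Qed.

(** Each side contributes a relatively open edge to the boundary of the cell. *)
Definition irredundant L := forall i, (i < size L)%N ->
  exists2 m, side L i m = 0 &
    forall j, (j < size L)%N -> j != i -> 0 < side L j m.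

(** Let [m i] be a point of the relative interior of the i-th edge. It is not
    in the cell, so some half-plane of [l] misses it. One half-plane cannot
    miss the points of two edges, since it would also miss their midpoint,
    which lies in the cell: this injects [L] into [l]. *)
Lemma irredundant_cell_size L l : irredundant L -> cell L = cell l ->
  (size L <= size l)%N.
Proof.
move=> irr eLl.
have /choice[m hm] : forall i, exists m, (i < size L)%N -> side L i m = 0 /\
    forall j, (j < size L)%N -> j != i -> 0 < side L j m.
  move=> i; have [iL|_] := ltnP i (size L); last by exists 0.
  by have [m ? ?] := irr i iL; exists m.
have m_ge i j : (i < size L)%N -> (j < size L)%N -> 0 <= side L j (m i).
  move=> iL jL; have [m0 mp] := hm i iL.
  by have [->|ji] := eqVneq j i; [rewrite m0|exact/ltW/mp].
(* The edge [i] is attached to the first half-plane of [l] that does not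
   contain [m i]. *)
pose bad i := fun e : pt * pt => orient e.1 e.2 (m i) <= 0.
have has_bad i : (i < size L)%N -> has (bad i) l.
  move=> iL; rewrite -[has _ _]negbK -all_predC; apply/negP => al.
  have : cell l (m i).
    by apply: sub_all al => e /=; rewrite /bad -ltNge.
  rewrite -eLl => /cellP/(_ i iL); have [-> _] := hm i iL.
  by rewrite ltxx.
pose phi i := find (bad i) l.
have phi_lt i : (i < size L)%N -> (phi i < size l)%N by move=> iL;
  rewrite -has_find has_bad.
have phi_inj : {in [pred i | (i < size L)%N] &, injective phi}.
  move=> i j; rewrite !inE => iL jL eij.
  apply/eqP/negPn/negP => nij.
  have bi : bad i (nth (0, 0) l (phi i)) by apply: nth_find; exact: has_bad.
  have bj : bad j (nth (0, 0) l (phi i)) by rewrite eij; apply: nth_find;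
    exact: has_bad.
  have : cell L (mix (m i) (m j) 2^-1).
    apply/cellP => r rL; rewrite side_mix.
    have := m_ge i r iL rL; have := m_ge j r jL rL.
    have [ri|ri] := eqVneq r i.
      have [_ /(_ r rL)] := hm j jL; rewrite ri => /(_ nij) ? ? ?; lra.
    have [_ /(_ r rL ri)] := hm i iL => ? ? ?; lra.
  rewrite eLl => /cellP/(_ _ (phi_lt i iL)).
  by rewrite side_mix /side => h; move: bi bj; rewrite /bad; lra.
have : uniq (map phi (iota 0 (size L))).
  rewrite map_inj_in_uniq ?iota_uniq// => i j;
    rewrite !mem_iota /= !add0n => iL jL.
  exact: phi_inj.
move=> /(@uniq_leq_size _ _ (iota 0 (size l))); rewrite size_map !size_iota;
  apply.
by move=> j /mapP[i]; rewrite !mem_iota /= !add0n => iL ->; exact: phi_lt.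
Qed.

Definition cyc_next k i := if i.+1 == k then 0%N else i.+1.

(** The line [L_i] carries the edge from [q_i] to the next corner, and all other
    corners lie strictly inside. The corners may turn either way. *)
Definition circuit q L := size L = size q /\
  forall i j, (i < size q)%N -> (j < size q)%N ->
    if (j == i) || (j == cyc_next (size q) i) then side L i q`_j = 0
    else 0 < side L i q`_j.

Section Circuit.
Variables (q : seq pt) (L : seq (pt * pt)).
Hypotheses (q3 : (3 <= size q)%N) (qL : circuit q L).

Lemma circuit_side i j : (i < size q)%N -> (j < size q)%N -> 0 <= side L i q`_j.
Proof.
by move=> iq jq; have [_ /(_ i j iq jq)] := qL; case: ifP => [_ ->|_ /ltW].
Qed.

Lemma cyc_next_lt i : (i < size q)%N -> (cyc_next (size q) i < size q)%N.
Proof. by rewrite /cyc_next; case: eqP; lia. Qed.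

Lemma circuit_hull :
  conv_hull [set` q] `<=` [set y | forall i, (i < size q)%N -> 0 <= side L i y].
Proof.
move=> y hy i iq; move/hullP: hy => /(_ [set z | 0 <= side L i z]).
apply; first exact: convex_halfplane.
move=> z /= zq; have := circuit_side iq; rewrite /side.
by move=> /(_ (index z q)); rewrite nth_index// index_mem => /(_ zq).
Qed.

(** The sum of the two sides through a corner vanishes there and is positive at
    every other corner. *)
Lemma circuit_convex_position : convex_position (fun i : 'I_(size q) => q`_i).
Proof.
move=> i /hullP.
pose p := if i == 0%N :> nat then (size q).-1 else i.-1.
have pq : (p < size q)%N by rewrite /p; case: eqP; have := ltn_ord i; lia.
have cp : cyc_next (size q) p = i by rewrite /cyc_next /p; have := ltn_ord i;
  do 2?[case: eqP => //]; lia.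
pose B := [set y | 0 < side L i y + side L p y].
have cB : convex B.
  move=> y z t; rewrite /B /= => hy hz t01.
  have h := mix_gt0 t01 hy hz.
  by move: h; rewrite !side_mix; lra.
move/(_ B cB); rewrite /B /=.
have [_ H] := qL.
have := H i i (ltn_ord i) (ltn_ord i); rewrite eqxx /= => ->.
have := H p i pq (ltn_ord i); rewrite cp eqxx orbT => ->.
rewrite addr0 ltxx => h; suff : false by []; apply: h => _ [j /= ji <-].
have := H i j (ltn_ord i) (ltn_ord j); have := H p j pq (ltn_ord j).
have -> : (j == i :> nat) = false by apply/negbTE.
rewrite cp [X in _ || X](_ : _ = false) ?orbF; last by apply/negbTE.
case: eqP => [jp|_] /= h1; case: eqP => [jc|_] h2; try lra.
by exfalso; move: jc; rewrite jp /cyc_next /p; have := ltn_ord i;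
  do 2?case: eqP; lia.
Qed.

Lemma circuit_midpoint i j : (i < size q)%N -> (j < size q)%N -> j != i ->
  0 < side L j (mix q`_i q`_(cyc_next (size q) i) 2^-1).
Proof.
move=> iq jq ji; have [_ H] := qL; rewrite side_mix.
have := H j i jq iq; have := H j _ jq (cyc_next_lt iq).
have -> : (i == j) = false by rewrite eq_sym; apply/negbTE.
rewrite /=.
case: ifP => [/orP[/eqP e1|/eqP e1]|_] h1; case: ifP => [/eqP e2|_] h2; try lra.
- exfalso; move/eqP: ji e1 e2; rewrite /cyc_next; do 2?case: eqP; lia.
- exfalso; move/eqP: ji e1 e2; rewrite /cyc_next; do 2?case: eqP; lia.
Qed.

Lemma circuit_irredundant : irredundant L.
Proof.
move=> i; have [-> H] := qL => iq.
exists (mix q`_i q`_(cyc_next (size q) i) 2^-1); last by move=> j jq ji;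
  exact: circuit_midpoint.
rewrite side_mix; have := H i i iq iq; have := H i _ iq (cyc_next_lt iq).
by rewrite !eqxx orbT /= => -> ->; rewrite !mulr0 addr0.
Qed.

Lemma circuit_nonempty : exists2 x, cell L x & conv_hull [set` q] x.
Proof.
have [eL H] := qL.
have half : 0 <= (2^-1 : R) <= 1 by lra.
pose m i := mix q`_i q`_(cyc_next (size q) i) 2^-1.
have hm i : (i < size q)%N -> conv_hull [set` q] (m i).
  move=> iq; apply: convex_hull => //; apply: sub_hull => /=; rewrite mem_nth//.
  exact: cyc_next_lt.
exists (mix (m 0%N) (m 1%N) 2^-1); last first.
  by apply: convex_hull => //; apply: hm; lia.
apply/cellP => i; rewrite eL => iq; rewrite side_mix.
have q0 : (0 < size q)%N by lia.
have q1 : (1 < size q)%N by lia.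
have hge j : (j < size q)%N -> 0 <= side L i (m j).
  by move=> jq; exact: (circuit_hull (hm j jq)).
have := hge _ q0; have := hge _ q1.
have [i0|i0] := eqVneq i 0%N.
  have := circuit_midpoint q1 iq; rewrite i0 => /(_ isT).
  by rewrite -/(m 1%N); lra.
by have := circuit_midpoint q0 iq i0; rewrite -/(m 0%N); lra.
Qed.

Lemma interior_circuit_sub : interior (conv_hull [set` q]) `<=` cell L.
Proof.
have [eL H] := qL.
move=> y iy; apply/cellP => i; rewrite eL => iq.
have hy := circuit_hull (interior_subset iy) iq.
rewrite lt_neqAle hy andbT; apply/negP => /eqP y0.
pose j := cyc_next (size q) (cyc_next (size q) i).
have jq : (j < size q)%N by do 2!apply: cyc_next_lt.
have [t t0 /circuit_hull/(_ i iq)] := interior_overshoot q`_j iy.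
rewrite side_mix -y0 mulr0 add0r mulNr oppr_ge0 => h.
have := H i j iq jq; rewrite [X in if X then _ else _](_ : _ = false).
  by move=> h'; have := mulr_gt0 t0 h'; lra.
by rewrite /j /cyc_next; apply/negbTE; do 3?case: eqP; lia.
Qed.

End Circuit.

(** Reads off the sign of a barycentric coordinate [v] relative to the area [D]
    from an instance of [orient_bary] in which two of the three terms vanish. *)
Lemma scaled_sign (D c u v : R) : D * u = v * c -> 0 < c -> 0 <= u ->
  0 <= D * v.
Proof.
move=> e c0 u0; rewrite -(pmulr_lge0 _ c0) -mulrA -e mulrA -expr2.
by rewrite mulr_ge0// sqr_ge0.
Qed.

Lemma triangle_cell_sub q L : size q = 3 -> circuit q L ->
  cell L `<=` conv_hull [set` q].
Proof.
case: q => [|q0 [|q1 [|q2 []]]]// _ [/= eL H] y /cellP; rewrite eL => hy.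
have := H 0%N 0%N isT isT; have := H 0%N 1%N isT isT; have := H 0%N 2%N isT isT.
have := H 1%N 0%N isT isT; have := H 1%N 1%N isT isT; have := H 1%N 2%N isT isT.
have := H 2%N 0%N isT isT; have := H 2%N 1%N isT isT; have := H 2%N 2%N isT isT.
have := hy 0%N isT; have := hy 1%N isT; have := hy 2%N isT.
rewrite /side /=.
set e0 := nth _ L 0; set e1 := nth _ L 1; set e2 := nth _ L 2.
move=> /ltW y2 /ltW y1 /ltW y0 h22 h21 h20 h12 h11 h10 h02 h01 h00.
have B0 w := orient_bary e0.1 e0.2 q0 q1 q2 w.
have B1 w := orient_bary e1.1 e1.2 q0 q1 q2 w.
have B2 w := orient_bary e2.1 e2.2 q0 q1 q2 w.
have mem x : x \in [:: q0; q1; q2] -> conv_hull [set` [:: q0; q1; q2]] x.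
  by move=> ?; exact: sub_hull.
apply: (@convex_triangle _ q0 q1 q2 y (@convex_hull _ _)); try by apply: mem;
  rewrite !inE eqxx ?orbT.
- apply/negP => /eqP D0.
  suff e : q0 = q1 by move: h10; rewrite e h11 ltxx.
  apply: orient_eq0 => w; have := B0 w.
  rewrite D0 h00 h01 mul0r !mulr0 !add0r => /esym/eqP;
    rewrite mulf_eq0 => /orP[/eqP//|/eqP h].
  by move: h02; rewrite h ltxx.
- by apply: (scaled_sign _ h10 y1); rewrite B1 h11 h12; ring.
- by apply: (scaled_sign _ h21 y2); rewrite B2 h20 h22; ring.
- by apply: (scaled_sign _ h02 y0); rewrite B0 h00 h01; ring.
Qed.

(** Cut along the diagonal [q0 q2]. The areas of the two halves have the same
    sign, because the sides [q0 q1] and [q3 q0] compare both with the area of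
    [q0 q1 q3]; so a point of the cell lies in the half on its side of the
    diagonal. *)
Lemma quad_cell_sub q L : size q = 4 -> circuit q L ->
  cell L `<=` conv_hull [set` q].
Proof.
case: q => [|q0 [|q1 [|q2 [|q3 []]]]]// _ [/= eL H] y /cellP; rewrite eL => hy.
have := H 0%N 0%N isT isT; have := H 0%N 1%N isT isT; have := H 0%N 2%N isT isT;
  have := H 0%N 3%N isT isT.
have := H 1%N 0%N isT isT; have := H 1%N 1%N isT isT; have := H 1%N 2%N isT isT.
have := H 2%N 0%N isT isT; have := H 2%N 2%N isT isT; have := H 2%N 3%N isT isT.
have := H 3%N 0%N isT isT; have := H 3%N 1%N isT isT; have := H 3%N 2%N isT isT;
  have := H 3%N 3%N isT isT.
have := hy 0%N isT; have := hy 1%N isT; have := hy 2%N isT; have := hy 3%N isT.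
rewrite /side /=.
set e0 := nth _ L 0; set e1 := nth _ L 1; set e2 := nth _ L 2;
  set e3 := nth _ L 3.
move=> /ltW y3 /ltW y2 /ltW y1 /ltW y0 h33 h32 h31 h30 h23 h22 h20 h12 h11 h10
  h03 h02 h01 h00.
have mem x : x \in [:: q0; q1; q2; q3] ->
    conv_hull [set` [:: q0; q1; q2; q3]] x.
  by move=> ?; exact: sub_hull.
pose D1 := orient q0 q1 q2; pose D2 := orient q0 q2 q3;
  pose D3 := orient q0 q1 q3.
have D1n : D1 != 0.
  apply/negP => /eqP D0.
  suff e : q0 = q1 by move: h10; rewrite e h11 ltxx.
  apply: orient_eq0 => w; have := orient_bary e0.1 e0.2 q0 q1 q2 w.
  rewrite -/D1 D0 h00 h01 mul0r !mulr0 !add0r => /esym/eqP;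
    rewrite mulf_eq0 => /orP[/eqP//|/eqP h].
  by move: h02; rewrite h ltxx.
have E1 : D1 * orient e0.1 e0.2 q3 = D3 * orient e0.1 e0.2 q2.
  by rewrite /D1 orient_bary h00 h01 /D3; ring.
have E3 : D3 * orient e3.1 e3.2 q2 = D2 * orient e3.1 e3.2 q1.
  by rewrite /D3 orient_bary h30 h33 /D2 (orient_rot q0 q2 q3)
    (orient_rot q2 q3 q0); ring.
have D12 : exists2 r, 0 < r & D2 = r * D1.
  exists (orient e0.1 e0.2 q3 / orient e0.1 e0.2
    q2 * (orient e3.1 e3.2 q2 / orient e3.1 e3.2 q1)).
    by rewrite mulr_gt0 ?divr_gt0.
  have n1 := lt0r_neq0 h31; have n2 := lt0r_neq0 h02.
  apply: (mulIf n1); rewrite -E3; apply: (mulIf n2).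
  rewrite mulrAC -E1; field; exact/andP.
have [r r0 D2E] := D12.
have D2n : D2 != 0 by rewrite D2E mulf_neq0// gt_eqF.
have [m0|m0] := leP 0 (D1 * orient q2 q0 y).
  apply: (@convex_triangle _ q0 q1 q2 y (@convex_hull _ _)); try by apply: mem;
    rewrite !inE eqxx ?orbT.
  - exact: D1n.
  - by apply: (scaled_sign _ h10 y1); rewrite orient_bary h11 h12; ring.
  - exact: m0.
  - by apply: (scaled_sign _ h02 y0); rewrite orient_bary h00 h01; ring.
apply: (@convex_triangle _ q0 q2 q3 y (@convex_hull _ _)); try by apply: mem;
  rewrite !inE eqxx ?orbT.
- exact: D2n.
- by apply: (scaled_sign _ h20 y2); rewrite orient_bary h22 h23; ring.
- by apply: (scaled_sign _ h32 y3); rewrite orient_bary h30 h33; ring.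
- rewrite -/D2 D2E (orient_swap q2 q0) -mulrA mulrN.
  by have : r * (D1 * orient q2 q0 y) < 0 by [rewrite pmulr_rlt0]; lra.
Qed.

Lemma interior_circuit q L : (2 < size q < 5)%N -> circuit q L ->
  interior (conv_hull [set` q]) = cell L.
Proof.
move=> /andP[q3 q5] qL; apply/seteqP; split; first exact: interior_circuit_sub.
rewrite -open_subsetE; last exact: open_cell.
have [q4|q4] : size q = 3%N \/ size q = 4%N by lia.
  exact: triangle_cell_sub.
exact: quad_cell_sub.
Qed.

Lemma bounded_hull q : bounded_set (conv_hull [set` q]).
Proof.
have [M hM] : exists M, forall x, x \in q -> `|x| <= M.
  elim: q => [|a q [M hM]]; first by exists 0.
  exists (Num.max `|a| M) => x; rewrite inE => /orP[/eqP ->|/hM h].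
    by rewrite le_max lexx.
  by rewrite le_max h orbT.
exists M; split; first exact: num_real.
move=> N MN y hy; apply: le_trans (ltW MN);
  move: y hy => y /= /hullP/(_ [set z | `|z| <= M]); apply; last by move=> x /=;
  exact: hM.
move=> a b t /= ha hb /andP[t0 t1]; rewrite /mix.
rewrite (le_trans (ler_normD _ _))// !normrZ (ger0_norm t0) ger0_norm
  ?subr_ge0//.
have := ler_wpM2l t0 hb; have := @ler_wpM2l R (1 - t) _ _ _ ha;
  rewrite subr_ge0 => /(_ t1); lra.
Qed.

End Cells.

(** * Points in convex position have a counterclockwise order *)
Section Order.
Variable R : realType.
Local Notation pt := (R * R)%type.
Implicit Types (a b c d x y z : pt) (s t : R) (A F : set pt).
Implicit Types (L l : seq (pt * pt)) (q : seq pt).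

Lemma orient0_mix a b y : a != b -> orient a b y = 0 -> exists t, y = mix a b t.
Proof.
move=> ab; rewrite /orient => h.
have [e1|n1] := eqVneq (b.1 - a.1) 0.
  have n2 : b.2 - a.2 != 0.
    apply: contra ab => /eqP e2; apply/eqP/injective_projections; lra.
  exists ((y.2 - a.2) / (b.2 - a.2)); apply: injective_projections;
    rewrite !mixE; last by field.
  have : (b.2 - a.2) * (y.1 - a.1) = 0 by move: h; rewrite e1; lra.
  move/eqP; rewrite mulf_eq0 (negbTE n2) /= => /eqP h2.
  have -> : b.1 = a.1 by lra.
  lra.
exists ((y.1 - a.1) / (b.1 - a.1)); apply: injective_projections; rewrite !mixE;
  first by field.
have -> : y.2 = a.2 + (b.2 - a.2) * (y.1 - a.1) / (b.1 - a.1).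
  by apply: (mulfI n1); rewrite mulrDr mulrCA divff// mulr1; lra.
by field.
Qed.

Lemma mix_sym a b t : mix a b t = mix b a (1 - t).
Proof. by apply: injective_projections; rewrite !mixE; ring. Qed.

(** Points are indexed by [nat] rather than by ordinals so that vertices such as
    v_(n-2) can be written down; only the indices below [n] matter. *)
Definition ccw n (v : nat -> pt) := forall i j k,
  (i < j)%N -> (j < k)%N -> (k < n)%N -> 0 < orient (v i) (v j) (v k).

Section ConvexPosition.
Variables (n : nat) (p : 'I_n -> pt).
Hypothesis pc : convex_position p.

Lemma convex_position_inj : injective p.
Proof.
move=> i j e; apply/eqP/negPn/negP => ij; apply: (pc (i := i)).
by apply: sub_hull; exists j; rewrite //= eq_sym.
Qed.

Lemma hull_others (i j : 'I_n) : j != i ->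
  conv_hull (p @` [set j | j != i]) (p j).
Proof. by move=> ji; apply: sub_hull; exists j. Qed.

Lemma convex_position_not_between (i j k : 'I_n) t :
  j != i -> k != i -> 0 <= t <= 1 -> p i <> mix (p j) (p k) t.
Proof.
move=> ji ki t01 e; apply: (pc (i := i)); rewrite e; apply: convex_hull => //;
  exact: hull_others.
Qed.

(** Of three collinear points one lies between the other two. *)
Lemma convex_position_orient_neq0 (i j k : 'I_n) : i != j -> j != k -> i != k ->
  orient (p i) (p j) (p k) != 0.
Proof.
move=> ij jk ik; apply/negP => /eqP h.
have pij : p i != p j by rewrite (inj_eq convex_position_inj).
have [t e] := orient0_mix pij h.
have [t0|t0] := ltP t 0.
  apply: (@convex_position_not_between i j k (1 / (1 - t))); rewrite 1?eq_sym//.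
    by rewrite divr_ge0 ?ler_pdivrMr; lra.
  have tn : 1 - t != 0 by lra.
  by rewrite e; apply: injective_projections; rewrite !mixE; field.
have [t1|t1] := leP t 1.
  by apply: (@convex_position_not_between k i j t) => //; rewrite t0.
apply: (@convex_position_not_between j i k (1 / t));
  rewrite 1?eq_sym// 1?eq_sym//.
  by rewrite divr_ge0 ?ler_pdivrMr; lra.
have tn : t != 0 by lra.
by rewrite e; apply: injective_projections; rewrite !mixE; field.
Qed.

Lemma convex_position_not_inside (i j k l : 'I_n) :
  i != l -> j != l -> k != l ->
  0 < orient (p i) (p j) (p k) -> 0 < orient (p j) (p k) (p l) ->
  0 < orient (p k) (p i) (p l) -> 0 < orient (p i) (p j) (p l) -> False.
Proof.
move=> il jl kl h h1 h2 h3; apply: (pc (i := l)).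
apply: (@convex_triangle _ _ (p i) (p j) (p k)); try exact: hull_others.
- exact: convex_hull.
- by rewrite gt_eqF.
- by rewrite ltW// mulr_gt0.
- by rewrite ltW// mulr_gt0.
- by rewrite ltW// mulr_gt0.
Qed.

End ConvexPosition.

End Order.

(** * The polygon of the vertices, its chords and its faces *)
Section Polygon.
Variable R : realType.
Local Notation pt := (R * R)%type.
Implicit Types (a b c d x y z : pt) (s t : R) (A F : set pt).
Implicit Types (L l : seq (pt * pt)) (q : seq pt) (v : nat -> pt).

Lemma orient_split a b c o :
  orient a b c = orient o a b + orient o b c + orient o c a.
Proof. by rewrite /orient; ring. Qed.

(** Sort the points by angle around the point [o] of index 0. If the angular
    comparison were not transitive, then [o] would lie inside a triangle of
    other points. If three sorted points turned clockwise, then the middle one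
    would lie in the triangle of [o] and the other two. *)
Lemma convex_position_ccw n (p : 'I_n -> pt) : (0 < n)%N -> convex_position p ->
  exists2 v, ccw n v & range p = v @` [set k | (k < n)%N].
Proof.
case: n p => // m p _ pc.
pose o : 'I_m.+1 := ord0; pose P i j k := orient (p i) (p j) (p k).
have Pn i j k : i != j -> j != k -> i != k -> P i j k != 0.
  by move=> *; exact: convex_position_orient_neq0.
pose r : rel 'I_m.+1 := fun i j => (i == j) || (0 < P o i j).
pose nz : {pred 'I_m.+1} := [pred i | i != o].
have r_total : {in nz &, total r}.
  move=> i j; rewrite !inE /r => io jo.
  have [//|ij] := eqVneq i j; rewrite /=.
  have /lt_total : P o i j != 0 by apply: Pn => //; rewrite eq_sym.
  have -> : (0 < P o j i) = (P o i j < 0) by rewrite /P orient_swapr oppr_gt0.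
  by rewrite orbC.
have r_trans : {in nz & &, transitive r}.
  move=> j i k; rewrite !inE /r => jo io ko.
  have [->//|ij] := eqVneq i j; have [->|jk] := eqVneq j k;
    first by move=> /= ->; rewrite orbT.
  move=> /= hij hjk; have [//|ik] := eqVneq i k; rewrite /= ltNge;
    apply/negP => hik.
  have hik' : 0 < P o k i.
    rewrite /P orient_swapr oppr_gt0 lt_neqAle hik andbT.
    by apply: Pn => //; rewrite eq_sym.
  apply: (convex_position_not_inside pc io jo ko).
  - rewrite (orient_split _ _ _ (p o)).
    by move: hij hjk hik'; rewrite /P => ? ? ?; apply: addr_gt0;
      first exact: addr_gt0.
  - by rewrite -orient_rot.
  - by rewrite -orient_rot.
  - by rewrite -orient_rot.
pose u := sort r [seq i <- enum 'I_m.+1 | i != o].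
have u_nz : all nz u by apply/allP => i; rewrite mem_sort mem_filter => /andP[].
have u_sorted : sorted r u.
  by apply: (sort_sorted_in r_total); apply/allP => i;
    rewrite mem_filter => /andP[].
have ou : uniq (o :: u).
  rewrite /= sort_uniq filter_uniq ?enum_uniq// andbT.
  by rewrite mem_sort mem_filter eqxx.
have mem_u i : i \in o :: u.
  by rewrite inE mem_sort mem_filter mem_enum andbT orbN.
have size_u : size (o :: u) = m.+1.
  rewrite -[RHS](size_enum_ord); apply/perm_size/uniq_perm;
    rewrite ?enum_uniq// => i.
  by rewrite mem_u mem_enum.
have u_r i j : (0 < i)%N -> (i < j)%N -> (j < m.+1)%N ->
  0 < P o (nth o (o :: u) i) (nth o (o :: u) j).
  move=> i0 ij jm.
  have := sorted_ltn_nth_in r_trans o u_nz u_sorted.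
  have su : size u = m by case: size_u.
  case: i i0 ij => // i _; case: j jm => // j jm ij.
  have im : (i < m)%N by lia.
  move=> /(_ i j); rewrite !inE su => /(_ im jm ij) /orP[|//].
  rewrite nth_uniq ?su//; last by move: ou => /andP[].
  by move=> /eqP e; move: ij; rewrite e ltnn.
exists (fun k => p (nth o (o :: u) k)).
  move=> i j k ij jk km.
  have nthn (a b : nat) : (a < b)%N -> (b < m.+1)%N ->
    nth o (o :: u) a != nth o (o :: u) b.
    by move=> ab bm; rewrite nth_uniq ?size_u//; lia.
  case: i ij => [|i] ij; first by apply: u_r => //; lia.
  have j0 : (0 < j)%N by lia.
  have k0 : (0 < k)%N by lia.
  have jm := ltn_trans jk km; have ik := ltn_trans ij jk;
    have im := ltn_trans ij jm.
  move: (u_r i.+1 j isT ij jm) (u_r j k j0 jk km) (u_r i.+1 k isT ik km).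
  move: (nthn 0%N i.+1 isT im) (nthn 0%N j j0 jm) (nthn 0%N k k0 km).
  move: (nthn _ _ ij jm) (nthn _ _ jk km) (nthn _ _ ik km).
  move: (nth o (o :: u) i.+1) (nth o (o :: u) j) (nth o (o :: u) k) => a b c.
  move=> ab bc ac /= oa ob oc h1 h2 h3.
  rewrite -/(P a b c) ltNge; apply/negP => habc.
  have h : 0 < orient (p a) (p c) (p b).
    by rewrite orient_swapr oppr_gt0 lt_neqAle habc Pn.
  apply: (convex_position_not_inside pc ob ab _ h3 h).
  - by rewrite eq_sym.
  - by rewrite orient_rot.
  - exact: h1.
apply/seteqP; split=> [_ [i _ <-]|_ [k _ <-]];
  last by exists (nth o (o :: u) k).
exists (index i (o :: u)); first by move: (mem_u i); rewrite -index_mem size_u.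
by rewrite nth_index// mem_u.
Qed.

(** Taking [i = j] yields the vertices, so that the drawing is described without
    a separate case for them. *)
Definition chords n v : set pt :=
  [set x | exists i j, [/\ (i < n)%N, (j < n)%N & segment (v i) (v j) x]].

Lemma drawing_chords n (p : 'I_n -> pt) v :
  range p = v @` [set k | (k < n)%N] -> drawing p = chords n v.
Proof.
move=> e.
have pv i : exists2 k, (k < n)%N & v k = p i.
  by have : range p (p i) by []; rewrite e.
have vp k : (k < n)%N -> exists i, p i = v k.
  move=> kn; have : (v @` [set k | (k < n)%N]) (v k) by exists k.
  by rewrite -e => -[i _ <-]; exists i.
have segxx (a : pt) : segment a a a.
  by exists 0; rewrite /= ?lexx ?ler01// subr0 scale1r scale0r addr0.
apply/seteqP; split=>
  [x [[i _ <-]|[i [j [ij h]]]]|x [i [j [/vp[i' <-] /vp[j' <-] h]]]].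
- have [k kn <-] := pv i; exists k, k; split=> //; exact: segxx.
- by have [k kn e1] := pv i; have [l ln e2] := pv j; exists k, l; rewrite e1 e2.
- have [e'|ij] := eqVneq i' j'; last by right; exists i', j'.
  left; exists i' => //; move: h => [t _ <-]; rewrite e'.
  by rewrite -scalerDl subrK scale1r.
Qed.

Lemma segmentP a b x : segment a b x <-> exists2 t, 0 <= t <= 1 & x = mix a b t.
Proof. by split=> [[t t01 <-]|[t t01 ->]]; exists t. Qed.

(** For three or more vertices in counterclockwise order this is their convex
    hull, as the intersection of its supporting half-planes. In this form it
    depends only on the set of vertices, and it can be compared directly with
    the cells of the lines through two of them. *)
Definition polygon n v : set pt :=
  [set y | forall i j, (i < n)%N -> (j < n)%N ->
     (forall k, (k < n)%N -> 0 <= orient (v i) (v j) (v k)) ->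
     0 <= orient (v i) (v j) y].

Lemma polygon_convex n v : convex (polygon n v).
Proof.
by move=> y z t hy hz t01 i j iN jN h; rewrite orient_mix mix_ge0 ?hy ?hz.
Qed.

Lemma vertex_polygon n v i : (i < n)%N -> polygon n v (v i).
Proof. by move=> iN j k jN kN; apply. Qed.

Lemma chords_polygon n v : chords n v `<=` polygon n v.
Proof.
move=> x [i [j [iN jN /segmentP[t t01 ->]]]].
by apply: polygon_convex => //; exact: vertex_polygon.
Qed.

Section CCW.
Variables (n : nat) (v : nat -> pt).
Hypotheses (n3 : (3 <= n)%N) (vc : ccw n v).

Lemma ccw_edge i k : (i < n)%N -> (k < n)%N -> k != i -> k != cyc_next n i ->
  0 < orient (v i) (v (cyc_next n i)) (v k).
Proof.
rewrite /cyc_next => iN kN ki; have [e|ne] := eqVneq i.+1 n => kc.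
  rewrite orient_rot; apply: vc; lia.
have [lt|ge] := ltnP k i; last by apply: vc; lia.
by rewrite -orient_rot; apply: vc; lia.
Qed.

Lemma ccw_neq i j : (i < n)%N -> (j < n)%N -> i != j -> v i != v j.
Proof.
wlog ij : i j / (i < j)%N => [H iN jN ij|iN jN _].
  have [lt|ge] := ltnP i j; first exact: H.
  by rewrite eq_sym H// 1?eq_sym//; lia.
apply/negP => /eqP e.
have [j' [jN' jj ij']] : exists j', [/\ (j' < n)%N, j' != i & j' != j].
  case: (eqVneq i 0%N) => i0; last by exists 0%N; split; lia.
  case: (eqVneq j 1%N) => j1; last by exists 1%N; split; lia.
  by exists 2%N; split; lia.
suff : orient (v i) (v j) (v j') != 0
  by rewrite e /orient !subrr !mul0r subrr eqxx.
have [lt|ge] := ltnP j' i.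
  by rewrite -orient_rot gt_eqF// vc//; lia.
have [lt'|ge'] := ltnP j' j.
  by rewrite orient_swapr oppr_eq0 gt_eqF// vc//; lia.
by rewrite gt_eqF// vc//; lia.
Qed.

Lemma edge_supporting i : (i < n)%N ->
  forall k, (k < n)%N -> 0 <= orient (v i) (v (cyc_next n i)) (v k).
Proof.
move=> iN k kN.
have [->|ki] := eqVneq k i; first by rewrite orient_l.
have [->|kc] := eqVneq k (cyc_next n i); first by rewrite orient_r.
exact/ltW/ccw_edge.
Qed.

(** A point of the line [v i, v j] before [v i] lies outside one of the two
    edges at [v i]; the edge used is one that does not contain [v j]. *)
Lemma polygon_ray i j t : (i < n)%N -> (j < n)%N -> i != j ->
  polygon n v (mix (v i) (v j) t) -> 0 <= t.
Proof.
move=> iN jN ij h.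
have cN k : (k < n)%N -> (cyc_next n k < n)%N by rewrite /cyc_next; case: eqP;
  lia.
have [jc|jc] := eqVneq j (cyc_next n i).
  pose k := if i == 0%N then n.-1 else i.-1.
  have kN : (k < n)%N by rewrite /k; case: eqP; lia.
  have ck : cyc_next n k = i by rewrite /cyc_next /k; do 2?[case: eqP => //];
    lia.
  have := h k i kN iN; rewrite -{1 2}ck => /(_ (edge_supporting kN)).
  rewrite orient_mix {1}ck orient_r mulr0 add0r pmulr_lge0//.
  apply: ccw_edge => //; last by rewrite ck eq_sym.
  by rewrite jc /k /cyc_next; apply/eqP; do 2?case: eqP; lia.
have := h i _ iN (cN _ iN) (edge_supporting iN).
rewrite orient_mix orient_l mulr0 add0r pmulr_lge0//.
by apply: ccw_edge => //; rewrite eq_sym.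
Qed.

(** The reason why the faces inside the polygon are cells of full lines,
    although the drawing consists of segments only. *)
Lemma polygon_chord i j y : (i < n)%N -> (j < n)%N -> i != j ->
  polygon n v y -> orient (v i) (v j) y = 0 -> chords n v y.
Proof.
move=> iN jN ij hy h; exists i, j; split=> //; apply/segmentP.
have [t e] := orient0_mix (ccw_neq iN jN ij) h.
exists t => //; rewrite (@polygon_ray i j t) -?e//=.
rewrite -subr_ge0 (@polygon_ray j i (1 - t))// 1?eq_sym//.
by rewrite -mix_sym -e.
Qed.

Definition sides_at x :=
  [seq e <- [seq (v i, v j) | i <- iota 0 n, j <- iota 0 n]
     | 0 < orient e.1 e.2 x].

Lemma mem_sides_at x i j : (i < n)%N -> (j < n)%N -> 0 < orient (v i) (v j) x ->
  (v i, v j) \in sides_at x.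
Proof.
move=> iN jN h; rewrite mem_filter h; apply/allpairsP; exists (i, j).
by rewrite !mem_iota.
Qed.

Lemma sides_atP x e : e \in sides_at x ->
  exists i j, [/\ (i < n)%N, (j < n)%N, e = (v i, v j)
                 & 0 < orient (v i) (v j) x].
Proof.
rewrite mem_filter => /andP[h /allpairsP[[i j] /= []]].
rewrite !mem_iota /= !add0n => iN jN ee; exists i, j; split=> //.
by rewrite ee in h.
Qed.

(** Within the component of [x], the part that lies in the open cell of [x] is
    open, and it equals the part in the closed cell: a point of the closed cell
    is still in the polygon, so if it were on one of the lines it would be on a
    chord. *)
Lemma component_sub_cell x : polygon n v x -> ~ chords n v x ->
  connected_component (~` chords n v) x `<=` cell (sides_at x).
Proof.
move=> px nx; set C := connected_component _ _.
have Cc : connected C by exact: component_connected.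
have Csub : C `<=` ~` chords n v by exact: connected_component_sub.
have x_neq0 i j : (i < n)%N -> (j < n)%N -> i != j -> orient (v i) (v j) x != 0.
  by move=> iN jN ij; apply/negP => /eqP h; apply: nx;
    exact: (polygon_chord iN jN ij).
have xc : cell (sides_at x) x by apply/allP => e; rewrite mem_filter => /andP[].
suff <- : C `&` cell (sides_at x) = C by move=> y [].
apply: Cc.
- by exists x; split=> //; exact: connected_component_refl.
- by exists (cell (sides_at x)) => //; exact: open_cell.
exists (closed_cell (sides_at x)); first exact: closed_closed_cell.
apply/seteqP; split=> [y [Cy /allP h]|y [Cy /= /allP h]]; split=> //.
  by apply/allP => e /h /ltW.
have py : polygon n v y.
  move=> i j iN jN sup.
  have [->|ij] := eqVneq i j; first by rewrite /orient !subrr !mul0r subrr.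
  apply: (h (v i, v j)); apply: mem_sides_at => //.
  by rewrite lt_neqAle eq_sym x_neq0// px.
apply/allP => e ex; rewrite lt_neqAle h// andbT; apply/negP => /eqP y0.
have [i [j [iN jN ee ej]]] := sides_atP ex.
have ij : i != j.
  by apply/negP => /eqP ij; move: ej;
    rewrite ij /orient !subrr !mul0r subrr ltxx.
apply: (Csub y Cy); apply: (polygon_chord iN jN ij py).
by rewrite y0 ee.
Qed.

Definition vertex_lines L := forall e, e \in L ->
  exists i j, [/\ (i < n)%N, (j < n)%N & e = (v i, v j)].

Lemma component_cell x L : polygon n v x -> cell L x ->
  vertex_lines L ->
  (forall y, cell L y -> ~ chords n v y) ->
  connected_component (~` chords n v) x = cell L.
Proof.
move=> px Lx Lv LD; apply/seteqP; split.
  move=> y /(component_sub_cell px (LD x Lx)) /allP h; apply/allP => e eL.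
  have [i [j [iN jN ee]]] := Lv e eL; apply: h; rewrite ee.
  by apply: mem_sides_at => //; have := allP Lx e eL; rewrite ee.
apply: connected_component_max => //; apply: convex_connected;
  exact: convex_cell.
Qed.

Lemma circuit_kface (p : 'I_n -> pt) q L : range p = v @` [set k | (k < n)%N] ->
  (2 < size q < 5)%N -> circuit q L -> (forall x, x \in q -> polygon n v x) ->
  vertex_lines L ->
  (forall y, cell L y -> ~ chords n v y) ->
  exists F, kface p (size q) F.
Proof.
move=> pv qs qL qK Lv LD; have /andP[q3 _] := qs; exists (cell L).
have [x Lx qx] := circuit_nonempty q3 qL.
have px : polygon n v x.
  by move/hullP: qx; apply => //; exact: polygon_convex.
split.
- exists x; rewrite (drawing_chords pv); first exact: LD.
  by rewrite (@component_cell x L).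
- rewrite -(interior_circuit qs qL); have [M [Mr hM]] := bounded_hull q.
  by exists M; split=> // N /hM h y /interior_subset; exact: h.
- exists (conv_hull [set` q]); split; last by rewrite (interior_circuit qs qL).
  split=> //; exists (fun i => q`_i); split;
    first exact: (circuit_convex_position q3 qL).
  congr conv_hull; apply/seteqP; split=> [y /= yq|_ [i _ <-]].
    have iq : (index y q < size q)%N by rewrite index_mem.
    by exists (Ordinal iq) => //=; rewrite nth_index.
  by rewrite /= mem_nth.
Qed.

End CCW.

(** The ray from [x] pointing away from [d] avoids [K], hence [D], and is
    unbounded. *)
Lemma bounded_component_sub_convex (D K : set pt) d x :
  D d -> convex K -> D `<=` K -> ~ D x ->
    bounded_set (connected_component (~` D) x) -> K x.
Proof.
move=> Dd cK DK nDx [M [_ hM]]; apply: contrapT => nKx.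
pose ray := [set mix d x (1 + t) | t in [set t : R | 0 <= t]].
have rayD : ray `<=` ~` D.
  move=> _ [t /= t0 <-] /DK Kt; apply: nKx.
  have tn : 1 + t != 0 by lra.
  have -> : x = mix d (mix d x (1 + t)) (1 + t)^-1.
    by apply: injective_projections; rewrite !mixE; field.
  apply: cK => //; first exact: DK.
  by rewrite invr_ge0 invf_le1; lra.
have rayc : connected ray.
  apply: convex_connected => _ _ s [t1 /= t10 <-] [t2 /= t20 <-] s01.
  exists ((1 - s) * t1 + s * t2); first by rewrite /= mix_ge0.
  by apply: injective_projections; rewrite !mixE; ring.
have rayx : ray x.
  exists 0; rewrite /= ?lexx//; by apply: injective_projections; rewrite !mixE;
    ring.
have sub := connected_component_max rayx rayD rayc.
have xd : d != x by apply/eqP => e; apply: nKx; rewrite -e; exact: DK.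
have nd : 0 < `|x - d| by rewrite normr_gt0 subr_eq0 eq_sym.
pose N := `|M| + 1.
have /hM hN : M < N by rewrite /N; have := ler_norm M; lra.
(* At this parameter the ray has left the ball of radius [N]. *)
pose t := (N + `|d| + 1) / `|x - d|.
have t0 : 0 <= t by rewrite divr_ge0 ?addr_ge0//.
have /sub/hN /= : ray (mix d x (1 + t)) by exists t.
have -> : mix d x (1 + t) = d + (1 + t) *: (x - d).
  by apply: injective_projections; rewrite !mixE /=; rewrite /GRing.scale /=;
    ring.
apply/negP; rewrite -ltNge.
have h := lerB_normD ((1 + t) *: (x - d)) d.
rewrite addrC; apply: lt_le_trans h.
rewrite normrZ ger0_norm ?addr_ge0// mulrDl mul1r divfK ?gt_eqF//; lra.
Qed.

End Polygon.

(** * Triangular and quadrilateral faces *)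

(** Index arithmetic only: hypotheses about real numbers slow [lia] down. *)
Ltac index_lia :=
  repeat match goal with H : ?T |- _ =>
    lazymatch T with
    | nat => fail
    | is_true (leq _ _) => fail
    | @eq nat _ _ => fail
    | _ => clear H
    end
  end; lia.

Section Faces.
Variable R : realType.
Local Notation pt := (R * R)%type.
Implicit Types (a b c d x y z : pt) (s t : R) (A F : set pt).
Implicit Types (L l : seq (pt * pt)) (q : seq pt) (v : nat -> pt).

(** The half-open bounds on the parameters allow [c = d], which happens for the
    triangle [n = 3]. *)
Definition cross a c b d x := exists s t,
  [/\ 0 < s <= 1, 0 < t <= 1, x = mix a c s & x = mix b d t].

Lemma cross_exists a b c d : 0 < orient a b c -> 0 < orient a b d ->
  0 <= orient a c d -> 0 <= orient b c d -> exists x, cross a c b d x.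
Proof.
have E : orient a b d + orient b c d = orient a b c + orient a c d.
  by rewrite /orient; ring.
have E1 : (orient a b d + orient b c d) * a.1 + orient a b d * (c.1 - a.1) =
   (orient a b d + orient b c d) * b.1 + orient a b c * (d.1 - b.1).
  by rewrite /orient; ring.
have E2 : (orient a b d + orient b c d) * a.2 + orient a b d * (c.2 - a.2) =
   (orient a b d + orient b c d) * b.2 + orient a b c * (d.2 - b.2).
  by rewrite /orient; ring.
move: (orient a b c) (orient a b d) (orient a c d) (orient b c d) E E1 E2.
move=> u w f g E E1 E2 u0 w0 f0 g0.
have D0 : 0 < w + g by lra.
have Dn : w + g != 0 by rewrite gt_eqF.
exists (mix a c (w / (w + g))), (w / (w + g)), (u / (w + g)); split=> //.
- by rewrite divr_gt0//= ler_pdivrMr//; lra.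
- by rewrite divr_gt0//= ler_pdivrMr//; lra.
apply: injective_projections; rewrite !mixE; apply: (mulfI Dn).
  transitivity ((w + g) * a.1 + w * (c.1 - a.1)); first by field.
  by rewrite E1; field.
transitivity ((w + g) * a.2 + w * (c.2 - a.2)); first by field.
by rewrite E2; field.
Qed.

(** Let f and g be affine on a line, with values [f0], [f1], [g0], [g1] at the
    parameters 0 and 1. As f is positive at 0, the signs at [s] and [t] force
    [t <= s]; then the value of g at [t] is a convex combination of those at 0
    and [s]. *)
Lemma affine_before_zero (s t f0 f1 g0 g1 : R) : 0 < s -> 0 < t ->
  0 < f0 -> (1 - s) * f0 + s * f1 <= 0 -> 0 <= (1 - t) * f0 + t * f1 ->
  0 <= g0 -> 0 <= (1 - s) * g0 + s * g1 -> 0 <= (1 - t) * g0 + t * g1.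
Proof.
move=> s0 t0 f00 fs ft g00 gs.
have ts : t <= s.
  have h1 : s * ((1 - t) * f0 + t * f1) - t * ((1 - s) * f0 + s * f1) =
      (s - t) * f0 by ring.
  have h2 := mulr_ge0 (ltW s0) ft.
  have h3 : t * ((1 - s) * f0 + s * f1) <= 0 by rewrite pmulr_rle0.
  have : 0 <= (s - t) * f0 by lra.
  by rewrite pmulr_lge0// subr_ge0.
rewrite -(pmulr_rge0 _ s0).
have -> : s * ((1 - t) * g0 + t * g1) =
    t * ((1 - s) * g0 + s * g1) + (s - t) * g0 by ring.
by rewrite addr_ge0 ?mulr_ge0 ?subr_ge0 ?(ltW t0).
Qed.

(** To separate a cell from a chord by a line that is not one of its sides, it
    is enough to look at its corners. *)
Lemma cell_pos q L a b z y : (2 < size q < 5)%N -> circuit q L ->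
  (forall x, x \in q -> 0 <= orient a b x) -> 0 < orient a b z ->
  cell L y -> 0 < orient a b y.
Proof.
move=> qs qL hq hz; rewrite -(interior_circuit qs qL) => iy.
have hull_ge x : conv_hull [set` q] x -> 0 <= orient a b x.
  by move/hullP/(_ _ (@convex_halfplane R a b)); apply.
rewrite lt_neqAle hull_ge ?andbT; last exact: interior_subset.
apply/negP => /eqP y0; have [t t0 /hull_ge] := interior_overshoot z iy.
rewrite orient_mix -y0 mulr0 add0r mulNr oppr_ge0 => h.
by have := mulr_gt0 t0 hz; lra.
Qed.

Lemma side_excludes_segment a b c d y : segment c d y ->
  0 < orient a b y -> orient a b c <= 0 -> orient a b d <= 0 -> False.
Proof.
move=> /segmentP[t t01 ->] + hc hd; apply/negP; rewrite -leNgt orient_mix.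
rewrite -oppr_ge0 opprD -!mulrN; apply: mix_ge0 => //; by rewrite oppr_ge0.
Qed.

Lemma chords_sorted n v y : chords n v y ->
  exists i j, [/\ (i <= j)%N, (j < n)%N & segment (v i) (v j) y].
Proof.
move=> [i [j [iN jN h]]]; have [ij|/ltnW ji] := leqP i j; first by exists i, j.
exists j, i; split=> //; move/segmentP: h => [t t01 ->]; apply/segmentP.
by exists (1 - t); [lra|exact: mix_sym].
Qed.

(** The cell between two lines through [a] and two lines through [b], with
    [xij] the crossing of the line to [ai] with the line to [bj]. *)
Lemma grid_circuit a b a1 a2 b1 b2 x11 x12 x21 x22 :
  0 < orient a a1 a2 -> 0 < orient b b2 b1 ->
  cross a a1 b b1 x11 -> cross a a1 b b2 x12 ->
  cross a a2 b b1 x21 -> cross a a2 b b2 x22 ->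
  circuit [:: x11; x21; x22; x12] [:: (b1, b); (a2, a); (b, b2); (a, a1)].
Proof.
move=> ha hb [s11 [t11 [/andP[s11p _] /andP[t11p _] ea11 eb11]]].
move=> [s12 [t12 [/andP[s12p _] /andP[t12p _] ea12 eb12]]].
move=> [s21 [t21 [/andP[s21p _] /andP[t21p _] ea21 eb21]]].
move=> [s22 [t22 [/andP[s22p _] /andP[t22p _] ea22 eb22]]].
have ha' : 0 < orient a2 a a1 by rewrite orient_rot.
have hb' : 0 < orient b1 b b2 by rewrite orient_rot.
split=> // -[|[|[|[|//]]]] [|[|[|[|//]]]] _ _ /=; rewrite /side /=;
  first [ by rewrite ?eb11 ?eb12 ?eb21 ?eb22 orient_mix ?orient_l ?orient_r
    !mulr0 addr0
        | by rewrite ?ea11 ?ea12 ?ea21 ?ea22 orient_mix ?orient_l ?orient_r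
          !mulr0 addr0
        | by rewrite ?eb11 ?eb12 ?eb21 ?eb22 orient_mix ?orient_l ?orient_r
          mulr0 add0r mulr_gt0
        | by rewrite ?ea11 ?ea12 ?ea21 ?ea22 orient_mix ?orient_l ?orient_r
          mulr0 add0r mulr_gt0].
Qed.

Section CCW.
Variables (n : nat) (v : nat -> pt).
Hypotheses (n3 : (3 <= n)%N) (vc : ccw n v).

Lemma ccw_le i j k : (i <= j)%N -> (j <= k)%N -> (k < n)%N ->
  0 <= orient (v i) (v j) (v k).
Proof.
move=> ij jk kn; have [->|ij'] := eqVneq i j.
  by rewrite /orient !subrr !mul0r subrr.
have [->|jk'] := eqVneq j k; first by rewrite orient_r.
by apply/ltW/vc => //; rewrite ltn_neqAle ?ij' ?jk'.
Qed.

Lemma cross_polygon i j c d x : (i < n)%N -> (j < n)%N ->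
  cross (v i) (v j) c d x -> polygon n v x.
Proof.
move=> iN jN [s [t [/andP[s0 s1] _ -> _]]].
apply: polygon_convex; [exact: vertex_polygon|exact: vertex_polygon|].
by rewrite (ltW s0).
Qed.

Definition edge_sides := [:: (v 0, v 1%N); (v 1%N, v n.-1); (v 2%N, v 0)].

Lemma edge_sides_vertices : vertex_lines n v edge_sides.
Proof.
move=> e; rewrite !inE => /or3P[] /eqP ->.
- by exists 0%N, 1%N; split=> //; index_lia.
- by exists 1%N, n.-1; split=> //; index_lia.
- by exists 2%N, 0%N; split=> //; index_lia.
Qed.

(** The corner between the edge [v 0, v 1] and the lines [v 0, v 2] and
    [v 1, v n.-1] is empty: chords that do not end at [v 0] are on or beyond
    [v 1, v n.-1], and those from [v 0] to later vertices than [v 1] are on or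
    beyond [v 0, v 2]. *)
Lemma edge_sides_chords y : cell edge_sides y -> ~ chords n v y.
Proof.
move=> /and4P[/= y0 y1 y2 _] /chords_sorted[[|i] [j [ij jn h]]]; last first.
  apply: (side_excludes_segment h y1); rewrite orient_swapr oppr_le0 ccw_le//;
    index_lia.
have [j1|j2] := leqP j 1%N.
  apply: (side_excludes_segment h y0); rewrite orient_swapr oppr_le0 ccw_le//;
    index_lia.
apply: (side_excludes_segment h y2);
  rewrite ?orient_r// orient_swap oppr_le0 ccw_le//; index_lia.
Qed.

Lemma exists_triangle (p : 'I_n -> pt) : range p = v @` [set k | (k < n)%N] ->
  exists F, kface p 3 F.
Proof.
move=> pv.
have [x mx] : exists x, cross (v 0%N) (v 2%N) (v 1%N) (v n.-1) x.
  apply: cross_exists; try (apply: vc; index_lia); apply: ccw_le; index_lia.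
apply: (@circuit_kface _ n v n3 vc p [:: v 0%N; v 1%N; x] edge_sides pv) => //.
- have [s [t [/andP[s0 _] /andP[t0 _] e1 e2]]] := mx.
  split=> // -[|[|[|//]]] [|[|[|//]]] _ _ /=; rewrite /side /=.
  + exact: orient_l.
  + exact: orient_r.
  + by rewrite e1 orient_mix orient_l mulr0 add0r mulr_gt0// vc.
  + by rewrite -orient_rot vc//; index_lia.
  + exact: orient_l.
  + by rewrite e2 orient_mix orient_l orient_r !mulr0 addr0.
  + exact: orient_r.
  + by rewrite orient_rot vc.
  + by rewrite e1 orient_mix orient_l orient_r !mulr0 addr0.
- move=> y; rewrite !inE => /or3P[] /eqP ->.
  + by apply: vertex_polygon; index_lia.
  + by apply: vertex_polygon; index_lia.
  + by apply: (@cross_polygon 0 2 (v 1%N) (v n.-1)) => //; index_lia.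
- exact: edge_sides_vertices.
- exact: edge_sides_chords.
Qed.

Lemma grid_kface (p : 'I_n -> pt) i j i1 i2 j1 j2 x11 x12 x21 x22 :
  range p = v @` [set k | (k < n)%N] ->
  all (fun k => (k < n)%N) [:: i; j; i1; i2; j1; j2] ->
  0 < orient (v i) (v i1) (v i2) -> 0 < orient (v j) (v j2) (v j1) ->
  cross (v i) (v i1) (v j) (v j1) x11 -> cross (v i) (v i1) (v j) (v j2) x12 ->
  cross (v i) (v i2) (v j) (v j1) x21 -> cross (v i) (v i2) (v j) (v j2) x22 ->
  (forall y, cell [:: (v j1, v j); (v i2, v i); (v j, v j2); (v i, v i1)] y ->
     ~ chords n v y) ->
  exists F, kface p 4 F.
Proof.
move=> pv /and5P[iN jN i1N i2N /and3P[j1N j2N _]] hi hj m11 m12 m21 m22.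
apply: (@circuit_kface _ n v n3 vc p [:: x11; x21; x22; x12] _ pv) => //.
- exact: grid_circuit.
- move=> x; rewrite !inE => /or4P[] /eqP ->.
  + exact: cross_polygon m11.
  + exact: cross_polygon m21.
  + exact: cross_polygon m22.
  + exact: cross_polygon m12.
- move=> e; rewrite !inE => /or4P[] /eqP ->.
  + by exists j1, j.
  + by exists i2, i.
  + by exists j, j2.
  + by exists i, i1.
Qed.

Section SixPoints.
Hypothesis n6 : (6 <= n)%N.

(** The only chords not excluded by a side of the cell join two of v_2, ...,
    v_(n-1); they lie on or beyond the chord v_2v_(n-1), and no corner of the
    cell lies strictly beyond it. *)
Lemma exists_quad_near (p : 'I_n -> pt) x :
  range p = v @` [set k | (k < n)%N] ->
  cross (v 0%N) (v 3%N) (v 1%N) (v n.-2) x -> 0 <= orient (v 2%N) (v n.-1) x ->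
  exists F, kface p 4 F.
Proof.
move=> pv x22 hx.
have [x11 m11] : exists x, cross (v 0%N) (v 2%N) (v 1%N) (v n.-1) x.
  by apply: cross_exists; try (apply: vc; index_lia); apply: ccw_le; index_lia.
have [x12 m12] : exists x, cross (v 0%N) (v 2%N) (v 1%N) (v n.-2) x.
  by apply: cross_exists; try (apply: vc; index_lia); apply: ccw_le; index_lia.
have [x21 m21] : exists x, cross (v 0%N) (v 3%N) (v 1%N) (v n.-1) x.
  by apply: cross_exists; try (apply: vc; index_lia); apply: ccw_le; index_lia.
have o1 : 0 < orient (v 0%N) (v 2%N) (v 3%N) by apply: vc; index_lia.
have o2 : 0 < orient (v 1%N) (v n.-2) (v n.-1) by apply: vc; index_lia.
apply: (grid_kface pv _ o1 o2 m11 m12 m21 x22); first by apply/and5P; split;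
  rewrite /= ?andbT; index_lia.
move=> y cy; have y4 : 0 < orient (v 2%N) (v n.-1) y.
  have o0 : 0 < orient (v 2%N) (v n.-1) (v 0%N) by rewrite -orient_rot vc//;
    index_lia.
  apply: (cell_pos _ (grid_circuit o1 o2 m11 m12 m21 x22) _ o0 cy) => //.
  have h i : (i <= 2)%N -> 0 <= orient (v 2%N) (v n.-1) (v i).
    by move=> i2; rewrite -orient_rot ccw_le//; index_lia.
  have h1 z s : z = mix (v 1%N) (v n.-1) s -> 0 < s <= 1 ->
    0 <= orient (v 2%N) (v n.-1) z.
    move=> -> /andP[s0 s1];
      rewrite orient_mix orient_r mulr0 addr0 mulr_ge0 ?h// subr_ge0//.
  move: m11 m12 m21 => [? [t1 [_ ht1 _ e1]]] [s2 [? [hs2 _ e2 _]]]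
    [? [t3 [_ ht3 _ e3]]].
  move=> z; rewrite !inE => /or4P[] /eqP -> //.
  - exact: h1 e1 ht1.
  - exact: h1 e3 ht3.
  - rewrite e2 orient_mix orient_l mulr0 addr0 mulr_ge0 ?h//;
    move: hs2 => /andP[]; lra.
move: cy => /and5P[/= y0 y1 y2 y3 _] /chords_sorted[[|[|i]] [j [ij jn h]]].
- have [j2|j3] := leqP j 2%N.
    by apply: (side_excludes_segment h y3);
      rewrite orient_swapr oppr_le0 ccw_le//; index_lia.
  by apply: (side_excludes_segment h y1);
    rewrite ?orient_r// orient_swap oppr_le0 ccw_le//; index_lia.
- have [j2|j3] := leqP j n.-2.
    by apply: (side_excludes_segment h y2);
      rewrite orient_swapr oppr_le0 ccw_le//; index_lia.
  have ej : j = n.-1 by index_lia.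
  by apply: (side_excludes_segment h y0); rewrite ?ej ?orient_l ?orient_r.
- by apply: (side_excludes_segment h y4);
  rewrite orient_swapr oppr_le0 ccw_le//; index_lia.
Qed.

(** Here the side v_2v_(n-1) takes care of the chords among v_2, ..., v_(n-1),
    and the chords from v_0 to v_3, ..., v_(n-1) are the ones in question.
    They lie on or beyond the line v_0v_3. Coming from v_1, the line
    v_1v_(n-2) meets v_2v_(n-1) before v_0v_3 because [x] is beyond
    v_2v_(n-1), and v_1v_(n-3) meets v_2v_(n-1) closer to v_2 still; so no
    corner of the cell lies strictly beyond v_0v_3. *)
Lemma exists_quad_far (p : 'I_n -> pt) x :
  range p = v @` [set k | (k < n)%N] ->
  cross (v 0%N) (v 3%N) (v 1%N) (v n.-2) x -> orient (v 2%N) (v n.-1) x < 0 ->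
  exists F, kface p 4 F.
Proof.
move=> pv mx hx.
have crossing i j : (2 < i)%N -> (i < n.-1)%N -> j = 0%N \/ j = n.-1 ->
    exists x, cross (v 1%N) (v i) (v 2%N) (v j) x.
  move=> i2 iN [] ->; apply: cross_exists; try (apply: vc; index_lia);
    try (apply: ccw_le; index_lia);
    by rewrite -orient_rot ?vc ?ccw_le//; index_lia.
have [x11 m11] := crossing n.-1.-2 0%N ltac:(index_lia) ltac:(index_lia)
  (or_introl erefl).
have [x12 m12] := crossing n.-1.-2 n.-1 ltac:(index_lia) ltac:(index_lia)
  (or_intror erefl).
have [x21 m21] := crossing n.-2 0%N ltac:(index_lia) ltac:(index_lia)
  (or_introl erefl).
have [x22 m22] := crossing n.-2 n.-1 ltac:(index_lia) ltac:(index_lia)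
  (or_intror erefl).
have o1 : 0 < orient (v 1%N) (v n.-1.-2) (v n.-2) by apply: vc; index_lia.
have o2 : 0 < orient (v 2%N) (v n.-1) (v 0%N) by rewrite -orient_rot vc//;
  index_lia.
apply: (grid_kface pv _ o1 o2 m11 m12 m21 m22); first by apply/and5P; split;
  rewrite /= ?andbT; index_lia.
move=> y cy; have y4 : 0 < orient (v 3%N) (v 0%N) y.
  have o0 : 0 < orient (v 3%N) (v 0%N) (v 1%N) by rewrite orient_rot vc//;
    index_lia.
  apply: (cell_pos _ (grid_circuit o1 o2 m11 m12 m21 m22) _ o0 cy) => //.
  have f2 : 0 < orient (v 3%N) (v 0%N) (v 2%N) by rewrite orient_rot vc//;
    index_lia.
  have h z s : z = mix (v 2%N) (v 0%N) s -> 0 < s <= 1 ->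
    0 <= orient (v 3%N) (v 0%N) z.
    by move=> -> /andP[s0 s1];
      rewrite orient_mix orient_r mulr0 addr0 mulr_ge0 ?(ltW f2)// subr_ge0.
  move: m11 m12 m21 m22 mx => [? [t11 [_ ht11 _ e11]]]
    [s12 [t12 [hs12 ht12 e12 e12']]].
  move=> [? [t21 [_ ht21 _ e21]]] [s22 [t22 [hs22 ht22 e22 e22']]]
    [s [t [hs ht ex ex']]].
  have g22 : 0 <= orient (v 3%N) (v 0%N) x22.
    rewrite e22 orient_mix.
    apply: (@affine_before_zero t s22 (orient (v 2%N) (v n.-1) (v 1%N))
      (orient (v 2%N) (v n.-1) (v n.-2))); rewrite -?orient_mix -?ex' -?e22.
    - by case/andP: ht.
    - by case/andP: hs22.
    - by rewrite -orient_rot vc//; index_lia.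
    - exact: ltW.
    - by rewrite e22' orient_mix orient_l orient_r !mulr0 addr0.
    - exact: ltW.
    - by rewrite ex orient_mix orient_l orient_r !mulr0 addr0.
  have g12 : 0 <= orient (v 3%N) (v 0%N) x12.
    rewrite e12' orient_mix.
    apply: (@affine_before_zero t22 t12 (orient (v n.-2) (v 1%N) (v 2%N))
      (orient (v n.-2) (v 1%N) (v n.-1))); rewrite -?orient_mix -?e12' -?e22'.
    - by case/andP: ht22.
    - by case/andP: ht12.
    - by rewrite orient_rot vc//; index_lia.
    - by rewrite e22 orient_mix orient_l orient_r !mulr0 addr0.
    - rewrite e12 orient_mix orient_r mulr0 add0r mulr_ge0//;
      first by case/andP: hs12 => /ltW.
      by rewrite orient_rot ccw_le//; index_lia.
    - exact: ltW.
    - exact: g22.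
  move=> z; rewrite !inE => /or4P[] /eqP -> //.
  - exact: h e11 ht11.
  - exact: h e21 ht21.
move: cy => /and5P[/= y0 y1 y2 y3 _] /chords_sorted[[|[|i]] [j [ij jn h]]].
- have [j2|j3] := leqP j 2%N.
    by apply: (side_excludes_segment h y0);
      rewrite orient_swapr oppr_le0 ccw_le//; index_lia.
  by apply: (side_excludes_segment h y4);
    rewrite ?orient_r// orient_swap oppr_le0 ccw_le//; index_lia.
- have [j2|j3] := leqP j n.-1.-2.
    by apply: (side_excludes_segment h y3);
      rewrite orient_swapr oppr_le0 ccw_le//; index_lia.
  by apply: (side_excludes_segment h y1);
    rewrite ?orient_r// orient_swap oppr_le0 ccw_le//; index_lia.
- by apply: (side_excludes_segment h y2);
  rewrite orient_swapr oppr_le0 ccw_le//; index_lia.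
Qed.

Lemma exists_quad (p : 'I_n -> pt) : range p = v @` [set k | (k < n)%N] ->
  exists F, kface p 4 F.
Proof.
move=> pv.
have [x mx] : exists x, cross (v 0%N) (v 3%N) (v 1%N) (v n.-2) x.
  by apply: cross_exists; try (apply: vc; index_lia); apply: ccw_le; index_lia.
have [h|h] := leP 0 (orient (v 2%N) (v n.-1) x).
  exact: (exists_quad_near pv mx h).
exact: (exists_quad_far pv mx h).
Qed.

End SixPoints.
End CCW.
End Faces.

(** * At most five vertices *)
Section Small.
Variable R : realType.
Local Notation pt := (R * R)%type.
Implicit Types (a b c d x y z : pt) (s t : R) (A F : set pt).
Implicit Types (L l : seq (pt * pt)) (q : seq pt) (v : nat -> pt).

(** Renumbering the vertices lets a statement about the edge or the ear at one
    of them be used at all of them. *)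
Definition rotate n v : nat -> pt := fun i => v (cyc_next n i).

Lemma rotate_image n v : (0 < n)%N ->
  rotate n v @` [set k | (k < n)%N] = v @` [set k | (k < n)%N].
Proof.
move=> n0; apply/seteqP; split=> [_ [k /= kn <-]|_ [k /= kn <-]].
  by exists (cyc_next n k); rewrite //= /cyc_next; case: eqP; lia.
exists (if k == 0%N then n.-1 else k.-1); first by rewrite /=; case: eqP; lia.
rewrite /rotate; congr v; rewrite /cyc_next.
have [->|k0] := eqVneq k 0%N; first by case: eqP; lia.
by case: eqP; lia.
Qed.

Lemma ccw_rotate n v : ccw n v -> ccw n (rotate n v).
Proof.
move=> vc i j k ij jk kn; rewrite /rotate /cyc_next.
have -> : (i.+1 == n) = false by apply/eqP; lia.
have -> : (j.+1 == n) = false by apply/eqP; lia.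
case: eqP => [e|ne]; last by apply: vc; lia.
by rewrite -orient_rot; apply: vc; lia.
Qed.

Lemma chords_image n v w :
  v @` [set k | (k < n)%N] = w @` [set k | (k < n)%N] ->
  chords n v = chords n w.
Proof.
have sub u u' : u @` [set k | (k < n)%N] = u' @` [set k | (k < n)%N] ->
  chords n u `<=` chords n u'.
  move=> e x [i [j [iN jN h]]].
  have [i' iN' ei] : (u' @` [set k | (k < n)%N]) (u i) by rewrite -e; exists i.
  have [j' jN' ej] : (u' @` [set k | (k < n)%N]) (u j) by rewrite -e; exists j.
  by exists i', j'; rewrite ei ej.
by move=> e; apply/seteqP; split; exact: sub.
Qed.

Lemma polygon_image n v w :
  v @` [set k | (k < n)%N] = w @` [set k | (k < n)%N] ->
  polygon n v `<=` polygon n w.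
Proof.
move=> e x hx i j iN jN sup.
have [i' iN' ei] : (v @` [set k | (k < n)%N]) (w i) by rewrite e; exists i.
have [j' jN' ej] : (v @` [set k | (k < n)%N]) (w j) by rewrite e; exists j.
rewrite -ei -ej; apply: hx => // k kn; rewrite ei ej.
have [k' kN' <-] : (w @` [set k | (k < n)%N]) (v k) by rewrite -e; exists k.
exact: sup.
Qed.

(** The shapes of the bounded faces for n = 3, 4, 5: a triangle, for which
    having few sides is enough, or a true pentagon. *)
Definition non_quad_cell F := exists l,
  F = cell l /\ (size l = 3 \/ (size l = 5 /\ irredundant l)).

Section Rotations.
Variables (n : nat) (x : pt).
Hypothesis n3 : (3 <= n)%N.

(** [x] is a point of the polygon off the drawing. The hypotheses on [v] and [x]
    are bundled because they are transported together by rotations. *)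
Definition uncut v := [/\ ccw n v, polygon n v x & ~ chords n v x].
Definition face_at v := connected_component (~` chords n v) x.

Lemma uncut_rotate v : uncut v -> uncut (rotate n v).
Proof.
have n0 : (0 < n)%N by lia.
have e := rotate_image v n0.
move=> [vc vx nx]; split.
- exact: ccw_rotate.
- by apply: polygon_image vx; rewrite e.
- by rewrite (chords_image e).
Qed.

Lemma face_at_rotate v : face_at (rotate n v) = face_at v.
Proof. by rewrite /face_at (chords_image (rotate_image v _))//; lia. Qed.

Lemma iter_uncut v k : uncut v -> uncut (iter k (rotate n) v).
Proof. by move=> bv; elim: k => //= k; exact: uncut_rotate. Qed.

Lemma iter_face_at v k : face_at (iter k (rotate n) v) = face_at v.
Proof. by elim: k => //= k <-; exact: face_at_rotate. Qed.

Lemma uncut_neq0 v i j : uncut v -> (i < n)%N -> (j < n)%N -> i != j ->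
  orient (v i) (v j) x != 0.
Proof.
move=> [vc vx nx] iN jN ij; apply/negP => /eqP h; apply: nx.
exact: (polygon_chord n3 vc iN jN ij).
Qed.

Lemma uncut_edge v i : uncut v -> (i < n)%N ->
  0 < orient (v i) (v (cyc_next n i)) x.
Proof.
move=> bv iN; have [vc vx nx] := bv.
have cN : (cyc_next n i < n)%N by rewrite /cyc_next; case: eqP; lia.
rewrite lt_neqAle eq_sym; apply/andP; split; last first.
  by apply: vx => //; exact: edge_supporting.
apply: uncut_neq0 => //.
by rewrite /cyc_next; apply/eqP; case: eqP; lia.
Qed.

(** Here [x] is in the triangle along the edge [v 0, v 1]. *)
Lemma edge_face v : uncut v -> 0 < orient (v 1%N) (v n.-1) x ->
  0 < orient (v 2%N) (v 0%N) x -> non_quad_cell (face_at v).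
Proof.
move=> bv h1 h2; have [vc vx nx] := bv.
exists (edge_sides n v); split; last by left.
apply: component_cell => //; last 2 first.
- exact: edge_sides_vertices.
- exact: edge_sides_chords.
rewrite /cell /edge_sides /= h1 h2 !andbT.
have := uncut_edge bv (_ : (0 < n)%N); rewrite /cyc_next; case: eqP => [|_];
  first lia.
by apply; lia.
Qed.

Lemma iter_edge_face k v : uncut v ->
  0 < orient (iter k (rotate n) v 1%N) (iter k (rotate n) v n.-1) x ->
  0 < orient (iter k (rotate n) v 2%N) (iter k (rotate n) v 0%N) x ->
  non_quad_cell (face_at v).
Proof.
move=> /(iter_uncut k) bv h1 h2; rewrite -(iter_face_at v k).
exact: edge_face.
Qed.

End Rotations.

Lemma orient_total a b x : orient a b x != 0 ->
  0 < orient a b x \/ 0 < orient b a x.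
Proof.
by move=> /lt_total /orP[h|->]; [right; rewrite orient_swap oppr_gt0|left].
Qed.

Lemma non_quad_cell3 v x : uncut 3 x v -> non_quad_cell (face_at 3 x v).
Proof.
move=> bv; apply: (edge_face _ bv) => //.
  by have := @uncut_edge 3 x isT v 1 bv isT.
by have := @uncut_edge 3 x isT v 2 bv isT.
Qed.

(** The two diagonals cut the polygon into triangles, one along each edge. *)
Lemma non_quad_cell4 v x : uncut 4 x v -> non_quad_cell (face_at 4 x v).
Proof.
move=> bv.
have [h1|h1] := orient_total (@uncut_neq0 4 x isT v 1 3 bv isT isT isT);
have [h2|h2] := orient_total (@uncut_neq0 4 x isT v 0 2 bv isT isT isT).
- exact: (@iter_edge_face 4 x isT 3 v bv).
- exact: (@iter_edge_face 4 x isT 0 v bv).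
- exact: (@iter_edge_face 4 x isT 2 v bv).
- exact: (@iter_edge_face 4 x isT 1 v bv).
Qed.

(** The segment from [x] to the witness crosses the i-th line at a point
    strictly inside all other half-planes. *)
Lemma irredundant_witness L x : cell L x ->
  (forall i, (i < size L)%N -> exists2 w, side L i w < 0 &
     forall j, (j < size L)%N -> j != i -> 0 <= side L j w) -> irredundant L.
Proof.
move=> /cellP Lx H i iL; have [w wi wj] := H i iL.
have xi := Lx i iL; pose t := side L i x / (side L i x - side L i w).
have D0 : 0 < side L i x - side L i w by lra.
have Dn : side L i x - side L i w != 0 by rewrite gt_eqF.
have t0 : 0 < t by rewrite divr_gt0.
have t1 : t < 1 by rewrite ltr_pdivrMr//; lra.
exists (mix x w t).
  by rewrite side_mix /t; move: Dn; move: (side L i x) (side L i w) => u r Dn;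
    field.
move=> j jL ji; rewrite side_mix ltr_pwDl//.
  by apply: mulr_gt0; [rewrite subr_gt0|exact: Lx].
by apply: mulr_ge0; [exact: ltW|exact: wj].
Qed.

Section Pentagon.
Variables (v : nat -> pt) (x : pt).
Hypothesis bv : uncut 5 x v.

Let vc : ccw 5 v. Proof. by case: bv. Qed.

(** Proves a sign of [orient (v i) (v j) (v k)] for concrete indices by
    permuting them into increasing order. *)
Ltac orient_sign :=
  rewrite -?oppr_ge0 -?oppr_gt0 -?orient_swap;
  first [ by apply: (ccw_le vc) | by rewrite orient_rot; apply: (ccw_le vc)
        | by rewrite -orient_rot; apply: (ccw_le vc)
        | by apply: vc | by rewrite orient_rot; apply: vc
        | by rewrite -orient_rot; apply: vc ].

(** The triangle at the vertex [v 0] between its two diagonals, cut off by the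
    diagonal [v 1, v 4]. *)
Definition tip_sides := [:: (v 1%N, v 4%N); (v 0%N, v 2%N); (v 3%N, v 0%N)].

Lemma tip_sides_chords y : cell tip_sides y -> ~ chords 5 v y.
Proof.
move=> /and4P[/= y0 y1 y2 _] /chords_sorted[i [j [ij j5 h]]].
have [i0|i0] := posnP i.
  subst i; have [j2|j2] := leqP j 2%N.
    by apply: (side_excludes_segment h y1);
      move: j j2 {h ij j5} => [|[|[|//]]] _; orient_sign.
  by apply: (side_excludes_segment h y2);
    move: j j2 j5 {h ij} => [|[|[|[|[|//]]]]] // _ _; orient_sign.
have neg k : (0 < k)%N -> (k < 5)%N -> orient (v 1%N) (v 4%N) (v k) <= 0.
  by move: k => [|[|[|[|[|//]]]]] // _ _; orient_sign.
by apply: (side_excludes_segment h y0); apply: neg => //; lia.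
Qed.

(** The pentagon bounded by all five diagonals. *)
Definition core_sides :=
  [:: (v 4%N, v 1%N); (v 0%N, v 2%N); (v 1%N, v 3%N); (v 2%N, v 4%N);
  (v 3%N, v 0%N)].

Lemma core_sides_chords y : cell core_sides y -> ~ chords 5 v y.
Proof.
move=> /andP[/= y0 /and5P[y1 y2 y3 y4 _]] [i [j [i5 j5 h]]].
move: i j i5 j5 h => [|[|[|[|[|//]]]]] [|[|[|[|[|//]]]]] _ _ h;
first [ by apply: (side_excludes_segment h y0); orient_sign
      | by apply: (side_excludes_segment h y1); orient_sign
      | by apply: (side_excludes_segment h y2); orient_sign
      | by apply: (side_excludes_segment h y3); orient_sign
      | by apply: (side_excludes_segment h y4); orient_sign ].
Qed.

(** The vertex [v i] is beyond the i-th diagonal only. *)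
Lemma core_sides_irredundant : cell core_sides x -> irredundant core_sides.
Proof.
move=> /irredundant_witness; apply => i i5; exists (v i).
  by move: i i5 => [|[|[|[|[|//]]]]] _; rewrite /side /=; orient_sign.
move=> j; move: i i5 j => [|[|[|[|[|//]]]]] _ [|[|[|[|[|//]]]]] //= _ _;
  rewrite /side /=; orient_sign.
Qed.

Lemma tip_core_vertices L : L = tip_sides \/ L = core_sides ->
  vertex_lines 5 v L.
Proof.
case=> -> e; rewrite !inE.
  move=> /or3P[] /eqP ->;
    [by exists 1%N, 4%N|by exists 0%N, 2%N|by exists 3%N, 0%N].
by move=> /orP[|/or4P[]] /eqP ->;
  [exists 4%N, 1%N|exists 0%N, 2%N|exists 1%N, 3%N|exists 2%N, 4%N|exists 3%N,
  0%N].
Qed.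

Lemma core_face : cell core_sides x -> non_quad_cell (face_at 5 x v).
Proof.
move=> cx; have [_ vx nx] := bv; exists core_sides; split; last by right;
  split=> //; exact: core_sides_irredundant.
by apply: component_cell => //;
  [exact: tip_core_vertices (or_intror erefl)|exact: core_sides_chords].
Qed.

(** The triangle cut off by the diagonal [v 1, v 4] consists of the triangles
    along the two edges at [v 0] and the tip between them. *)
Lemma ear_face : 0 < orient (v 1%N) (v 4%N) x -> non_quad_cell (face_at 5 x v).
Proof.
move=> h0; have [_ vx nx] := bv.
have [h1|h1] := orient_total (@uncut_neq0 5 x isT v 0 2 bv isT isT isT);
  last first.
  exact: (@iter_edge_face 5 x isT 0 v bv).
have [h4|h4] := orient_total (@uncut_neq0 5 x isT v 3 0 bv isT isT isT);
  last first.
  exact: (@iter_edge_face 5 x isT 4 v bv).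
exists tip_sides; split; last by left.
apply: component_cell => //; last 2 first.
- exact: tip_core_vertices (or_introl erefl).
- exact: tip_sides_chords.
by rewrite /cell /tip_sides /= h0 h1 h4.
Qed.

End Pentagon.

Lemma non_quad_cell5 v x : uncut 5 x v -> non_quad_cell (face_at 5 x v).
Proof.
move=> bv.
have ear k : 0 < orient (iter k (rotate 5) v 1%N) (iter k (rotate 5) v 4%N) x ->
  non_quad_cell (face_at 5 x v).
  by rewrite -(@iter_face_at 5 x isT v k); apply: ear_face; exact: iter_uncut.
have [h0|h0] := orient_total (@uncut_neq0 5 x isT v 4 1 bv isT isT isT);
  last exact: (ear 0%N).
have [h1|h1] := orient_total (@uncut_neq0 5 x isT v 0 2 bv isT isT isT);
  last exact: (ear 1%N).
have [h2|h2] := orient_total (@uncut_neq0 5 x isT v 1 3 bv isT isT isT);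
  last exact: (ear 2%N).
have [h3|h3] := orient_total (@uncut_neq0 5 x isT v 2 4 bv isT isT isT);
  last exact: (ear 3%N).
have [h4|h4] := orient_total (@uncut_neq0 5 x isT v 3 0 bv isT isT isT);
  last exact: (ear 4%N).
by apply: core_face => //; rewrite /cell /core_sides /= h0 h1 h2 h3 h4.
Qed.

Lemma face_small_non_quad n v x : (3 <= n <= 5)%N -> uncut n x v ->
  non_quad_cell (face_at n x v).
Proof.
move=> /andP[]; case: n => [|[|[|[|[|[|//]]]]]] // _ _.
- exact: non_quad_cell3.
- exact: non_quad_cell4.
- exact: non_quad_cell5.
Qed.

Lemma convex_polygon4_cell (P : set pt) : convex_polygon 4 P ->
  exists L, [/\ size L = 4, irredundant L & interior P = cell L].
Proof.
move=> [_ [q [qc ->]]];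
  have [w wc e] := convex_position_ccw (isT : (0 < 4)%N) qc.
have -> : range q = [set` [:: w 0%N; w 1%N; w 2%N; w 3%N]].
  rewrite e; apply/seteqP; split=> [_ [[|[|[|[|//]]]] _ <-]|y /=].
  1-4: by rewrite /= !inE eqxx ?orbT.
  by rewrite !inE => /or4P[] /eqP ->;
    [exists 0%N|exists 1%N|exists 2%N|exists 3%N].
pose L := [:: (w 0%N, w 1%N); (w 1%N, w 2%N); (w 2%N, w 3%N); (w 3%N, w 0%N)].
have cL : circuit [:: w 0%N; w 1%N; w 2%N; w 3%N] L.
  split=> // -[|[|[|[|//]]]] [|[|[|[|//]]]] _ _ /=;
    rewrite /side /= ?orient_l ?orient_r//;
  first [by apply: wc | by rewrite orient_rot;
    apply: wc | by rewrite -orient_rot; apply: wc].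
exists L; split=> //; last exact: interior_circuit.
exact: circuit_irredundant cL.
Qed.

Lemma quad_non_quad_cell (P : set pt) : convex_polygon 4 P ->
  ~ non_quad_cell (interior P).
Proof.
move=> /convex_polygon4_cell[L [L4 irr ->]] [l [e []]].
  by move=> l3; have := irredundant_cell_size irr e; rewrite L4 l3.
by move=> [l5 irrl]; have := irredundant_cell_size irrl (esym e); rewrite L4 l5.
Qed.

Lemma convex_chords n v : (0 < n <= 2)%N -> convex (chords n v).
Proof.
move=> n2; have -> : chords n v = segment (v 0%N) (v n.-1).
  apply/seteqP; split=>
    [x /chords_sorted[i [j [ij jn /segmentP[t t01 ->]]]]|x h]; last first.
    by exists 0%N, n.-1; split=> //; lia.
  apply/segmentP.
  have [i0|i0] := posnP i; have [j0|j0] := posnP j; rewrite ?i0 ?j0.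
  - by exists 0; [rewrite lexx ler01|apply: injective_projections;
    rewrite !mixE; ring].
  - by exists t => //; congr (mix _ (v _) _); lia.
  - lia.
  - have -> : i = n.-1 by lia.
    have -> : j = n.-1 by lia.
    by exists 1; [rewrite lexx ler01|apply: injective_projections;
      rewrite !mixE; ring].
move=> a b t /segmentP[t1 h1 ->] /segmentP[t2 h2 ->] t01; apply/segmentP.
exists ((1 - t) * t1 + t * t2); last by apply: injective_projections;
  rewrite !mixE; ring.
move: h1 h2 => /andP[h1 h1'] /andP[h2 h2']; rewrite mix_ge0//=.
have := @mix_ge0 R (1 - t1) (1 - t2) t t01; rewrite !subr_ge0 => /(_ h1' h2');
  lra.
Qed.

(** With at most two vertices the drawing is a point or a segment. *)
Lemma no_bounded_face n v x : (0 < n <= 2)%N -> ~ chords n v x ->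
  ~ bounded_set (connected_component (~` chords n v) x).
Proof.
move=> n2 nx hb; apply: (nx); apply: bounded_component_sub_convex hb => //.
  exists 0%N, 0%N; split; [lia|lia|apply/segmentP].
  exists 0; [by rewrite lexx ler01|reflexivity].
exact: convex_chords.
Qed.

End Small.

Theorem proposition1 (R : realType) (n : nat) (p : 'I_n -> (R * R)%type) :
  (0 < n)%N ->
  convex_drawing p ->
  ((exists F, kface p 3 F) <-> (3 <= n)%N) /\
  ((exists F, kface p 4 F) <-> (6 <= n)%N).
Proof.
move=> n0 [_ /(convex_position_ccw n0)[v vc pv]].
have D := drawing_chords pv.
have big k F : kface p k F -> (3 <= n)%N.
  move=> [[x]]; rewrite D => nx -> hb _; rewrite leqNgt; apply/negP => n2.
  by apply: (no_bounded_face _ nx hb); lia.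
split; split.
- by move=> [F /big].
- by move=> n3; exact: (exists_triangle n3 vc pv).
- move=> [F kF]; have n3 := big _ _ kF; rewrite leqNgt; apply/negP => n5.
  have [[x]] := kF; rewrite D => nx eF bF [P [P4 FP]].
  apply: (quad_non_quad_cell P4); rewrite -FP eF.
  apply: face_small_non_quad; first by rewrite n3; lia.
  split=> //; rewrite eF in bF.
  apply: (bounded_component_sub_convex _ _ _ nx bF).
  + exists 0%N, 0%N; split=> //; apply/segmentP.
    exists 0; [by rewrite lexx ler01|reflexivity].
  + exact: polygon_convex.
  + exact: chords_polygon.
- by move=> n6; apply: (exists_quad _ vc n6 pv); lia.
Qed.
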